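(* Let $\mathcal{Q}$ be a class of linear queries over an item domain $\mathcal{X}$, and suppose there is a static $(\varepsilon,\delta)$-DP mechanism for answering $\mathcal{Q}$ with error function $\alpha^{(k)}(\varepsilon,\delta,\beta)$, $k\in\mathbb{N}$ (available for all values of the privacy and failure parameters). Then there is a dynamic $(\varepsilon,\delta)$-DP mechanism for infinite insertion-only streams such that, for every time $t$, with probability at least $1-\beta$ it answers every query in $\mathcal{Q}$ on the current dataset $D_t$ with error $$O\left(\alpha^{(\log m_t)}\left(\frac{\varepsilon}{\log m_t},\frac{\delta}{\log m_t},\beta\right)+\frac{1}{\varepsilon}\log\frac{t}{\beta}\right),\qquad m_t=n_t+\log\log t,$$ where $n_t=|D_t|$.
   Context: **Datasets and queries.** A dataset is a finite multiset $D\in\mathbb{N}^{\mathcal{X}}$ of items from $\mathcal{X}$. Set operations on multisets are multiset operations. A linear query is a function $f:\mathcal{X}\to[0,1]$, evaluated as $f(D)=\sum_{x\in D}f(x)$. $\mathcal{Q}$ is a finite set of linear queries. **Static DP.** Datasets $D\sim D'$ are neighbors if one is obtained from the other by adding one item. A randomized mechanism $\mathcal{M}$ is $(\varepsilon,\delta)$-DP if for all neighboring inputs $D\sim D'$ and all sets $Y$ of outputs, $\Pr[\mathcal{M}(D)\in Y]\le e^{\varepsilon}\Pr[\mathcal{M}(D')\in Y]+\delta$. A static mechanism for $\mathcal{Q}$ outputs a data structure $\mathcal{M}(D)$ from which an approximate answer $\mathcal{M}_f(D)$ can be extracted for each $f\in\mathcal{Q}$. **Error functions.** The static mechanism (run with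 privacy parameters $(\varepsilon,\delta)$) has error functions $\alpha^{(k)}$, $k\in\mathbb{N}$, if for all datasets $D^{(1)},\dots,D^{(k)}$, with independent runs on each, $$\Pr\Big[\max_{f\in\mathcal{Q}}\Big|\sum_{j=1}^k\mathcal{M}_f(D^{(j)})-f\big(\textstyle\bigcup_{j=1}^kD^{(j)}\big)\Big|>\alpha^{(k)}\Big]\le\beta .$$ Here $\alpha^{(k)}$ is a function of $\varepsilon,\delta,\beta$, and possibly also of the total data size $|D|=\sum_j|D^{(j)}|$, $|\mathcal{Q}|$ and $|\mathcal{X}|$; arguments not displayed are omitted from the notation (in the claim the omitted data size is $n_t$). It is assumed that $\alpha^{(k)}$ does not depend exponentially on any parameter, so constant factors in its arguments may be absorbed in $O(\cdot)$. **Insertion-only streams.** An infinite insertion-only stream is $\bm{x}=(x_1,x_2,\dots)$ with $x_i\in\mathcal{X}\cup\{\bot\}$. If $x_i=\bot$ nothing arrives at time $i$; otherwise item $x_i$ is inserted. The dataset at time $t$ is $D_t=\bigcup_{i\le t:\,x_i\ne\bot}\{x_i\}$. Two streams are neighbors if they differ at exactly one timestamp, where one of them has $\bot$. **Dynamic mechanism.** After every time step $t$ the mechanism releases a (possibly empty) output depending on the stream up to time $t$. It is $(\varepsilon,\delta)$-DP if the joint sequence of all releases satisfies the $(\varepsilon,\delta)$-DP inequality for neighboring streams. For each $t$ and $f\in\mathcal{Q}$ an approximation of $f(D_t)$ must be extractable from the releases up to time $t$; the error at time $t$ is the maximum over $f\in\mathcal{Q}$ of the absolute difference between this approximation and $f(D_t)$.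 **Conventions.** The mechanism may depend on $\varepsilon,\delta,\beta$ but not on $t$ or the stream length. Logarithmic quantities inside the $O(\cdot)$ bound are rounded up to integers where needed and read as at least $1$. *)

(* Defs.v *)
From HB Require Import structures.
From mathcomp Require Import all_boot all_order all_algebra.
From mathcomp Require Import finmap multiset.
From mathcomp Require Import all_classical all_reals all_analysis.

Set Implicit Arguments.
Unset Strict Implicit.
Unset Printing Implicit Defensive.

Import Order.TTheory GRing.Theory Num.Theory.

Local Open Scope classical_set_scope.
Local Open Scope mset_scope.
Local Open Scope ring_scope.

(* A finite set of linear queries on the items X is a family
   q : Q -> X -> R with Q : finType, and a dataset is a D : {mset X}; the
   multiset union is the sum `+` (multiplicities add up). *)

Definition linear_queries (R : realType) (X : choiceType) (Q : finType)
    (q : Q -> X -> R) : Prop :=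
  forall f x, 0 <= q f x <= 1.

Definition query (R : realType) (X : choiceType) (Q : finType)
    (q : Q -> X -> R) (f : Q) (D : {mset X}) : R :=
  \sum_(x <- D) q f x.

Definition max_error (R : realType) (Q : finType) (a b : Q -> R) : R :=
  \big[Num.max/0]_(f : Q) `|a f - b f|.

Definition neighbor (X : choiceType) (D D' : {mset X}) : Prop :=
  exists x : X, D' = (x +` D)%mset \/ D = (x +` D')%mset.

(* k independent runs: the product measure on k.-tuple T. *)
Section independent_runs.
Context (R : realType) (d : measure_display) (T : measurableType d).

Definition cons_tup (k : nat) (yz : T * k.-tuple T) : k.+1.-tuple T :=
  [tuple of yz.1 :: yz.2].

Lemma measurable_cons_tup (k : nat) : measurable_fun setT (@cons_tup k).
Proof. exact: measurable_cons. Qed.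

HB.instance Definition _ (k : nat) :=
  isMeasurableFun.Build _ _ _ _ (@cons_tup k) (@measurable_cons_tup k).

Fixpoint runs (k : nat) : ('I_k -> probability T R) ->
    probability (k.-tuple T) R :=
  match k with
  | 0 => fun=> \d_([tuple] : 0.-tuple T)
  | j.+1 => fun P =>
      distribution (P ord0 \x runs (fun i : 'I_j => P (lift ord0 i)))%E
        (@cons_tup j)
  end.

Lemma runs_box (k : nat) (P : 'I_k -> probability T R) (A : 'I_k -> set T) :
  (forall i, measurable (A i)) ->
  runs P [set y | forall i, A i (tnth y i)] = (\prod_(i < k) P i (A i))%E.
Proof.
elim: k P A => [|k IH] P A mA /=.
  rewrite big_ord0 diracE mem_set //=.
  by case.
rewrite big_ord_recl /distribution /pushforward.
rewrite -IH => [|i]; last exact: mA.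
rewrite -product_measure1E //; last first.
  rewrite (_ : [set _ | _] = \bigcap_(i in [set: 'I_k])
      ((fun y : k.-tuple T => tnth y i) @^-1` A (lift ord0 i))); last first.
    by apply/seteqP; split => y /= h i; [move=> _ |]; exact: h.
  apply: fin_bigcap_measurable => // i _.
  by rewrite -[X in measurable X]setTI; exact: measurable_tnth.
congr (product_measure1 _ _ _); apply/seteqP; split => -[z y] /=.
  move=> h; split; first exact: (h ord0).
  by move=> i; have := h (lift ord0 i); rewrite tnthS.
move=> [h0 h] i; case: (unliftP ord0 i) => [j ->|->]; last exact: h0.
by rewrite tnthS; exact: h.
Qed.

End independent_runs.

Record static_mechanism (R : realType) (X : choiceType) (Q : finType) := {
  static_display : measure_display;
  static_out : measurableType static_display;
  static_law : {mset X} -> probability static_out R;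
  static_answer : Q -> static_out -> R;
  measurable_static_answer : forall f, measurable_fun setT (static_answer f) }.

Definition static_DP (R : realType) (X : choiceType) (Q : finType)
    (eps delta : R) (M : static_mechanism R X Q) : Prop :=
  forall D D' : {mset X}, neighbor D D' ->
  forall S : set (static_out M), measurable S ->
  (static_law M D S <= (expR eps)%:E * static_law M D' S + delta%:E)%E.

Definition total_size (X : choiceType) (k : nat) (D : 'I_k -> {mset X}) : nat :=
  (\sum_(j < k) size (D j))%N.

Definition joint_error (R : realType) (X : choiceType) (Q : finType)
    (q : Q -> X -> R) (M : static_mechanism R X Q) (k : nat)
    (D : 'I_k -> {mset X}) (y : k.-tuple (static_out M)) : R :=
  max_error (fun f => \sum_(j < k) static_answer f (tnth y j))
            (fun f => query q f (\big[@msetD X/@mset0 X]_(j < k) D j)).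

(* alpha k n is the error bound of k runs on total data size n. *)
Definition has_error (R : realType) (X : choiceType) (Q : finType)
    (q : Q -> X -> R) (beta : R) (M : static_mechanism R X Q)
    (alpha : nat -> nat -> R) : Prop :=
  forall (k : nat) (D : 'I_k -> {mset X}), (0 < k)%N ->
  (runs (fun j => static_law M (D j))
     [set y | (alpha k (total_size D) < joint_error q D y)%R] <= beta%:E)%E.

(* Pure privacy is delta = 0, approximate privacy is 0 < delta < 1; keeping
   the two apart lets the static mechanism exist for delta > 0 only, as with
   Gaussian noise. *)
Definition admissible (R : realType) (pure : bool) (eps delta beta : R) : Prop :=
  [/\ 0 < eps, if pure then delta = 0 else 0 < delta < 1 & 0 < beta < 1].

Definition within (R : realType) (c a b : R) : Prop := a <= c * b /\ b <= c * a.

(* The standing assumption on error functions: changing every argument by at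
   most a factor c changes the value by at most a factor K c. No monotonicity
   is assumed. *)
Definition absorbs_constants (R : realType) (pure : bool) (K : R -> R)
    (alpha : nat -> R -> R -> R -> nat -> R) : Prop :=
  forall (c : R) (k k' : nat) (eps eps' delta delta' beta beta' : R) (n n' : nat),
    1 <= c -> (0 < k)%N -> (0 < k')%N ->
    admissible pure eps delta beta -> admissible pure eps' delta' beta' ->
    within c k%:R k'%:R -> within c eps eps' -> within c delta delta' ->
    within c beta beta' -> within c n%:R n'%:R ->
    alpha k' eps' delta' beta' n' <= K c * alpha k eps delta beta n.

(* Timestamps start at 1: x i is what arrives at time i.+1, None being an
   empty timestamp. *)
Definition stream (X : Type) := nat -> option X.

Definition dataset (X : choiceType) (x : stream X) (t : nat) : {mset X} :=
  seq_mset (pmap x (iota 0 t)).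

Definition stream_neighbor (X : Type) (x x' : stream X) : Prop :=
  exists i : nat, [/\ x i <> x' i, x i = None \/ x' i = None
    & forall j, j <> i -> x j = x' j].

(* The randomness is an outcome w of a probability space fixed in advance; the
   release after time t is a function of w and of the first t stream entries
   only, and an answer at time t is a function of the first t releases only. *)
Record dynamic_mechanism (R : realType) (X : choiceType) (Q : finType) := {
  seed_display : measure_display;
  seed : measurableType seed_display;
  seed_law : probability seed R;
  out_display : measure_display;
  out : measurableType out_display;
  release : seq (option X) -> seed -> out;
  measurable_release : forall s, measurable_fun setT (release s);
  answer : Q -> forall t : nat, t.-tuple out -> R;
  measurable_answer : forall f t, measurable_fun setT (@answer f t) }.

Definition releases (R : realType) (X : choiceType) (Q : finType)
    (N : dynamic_mechanism R X Q) (x : stream X) (w : seed N) : nat -> out N :=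
  fun i => release (mkseq x i.+1) w.

(* The product sigma-algebra on sequences. *)
Definition seq_measurable (d : measure_display) (T : measurableType d) :
    set (set (nat -> T)) :=
  <<s \bigcup_i preimage_set_system setT (fun y : nat -> T => y i) measurable >>.

Definition dynamic_DP (R : realType) (X : choiceType) (Q : finType)
    (eps delta : R) (N : dynamic_mechanism R X Q) : Prop :=
  forall x x' : stream X, stream_neighbor x x' ->
  forall S : set (nat -> out N), seq_measurable S ->
  (seed_law N [set w | S (releases x w)] <=
     (expR eps)%:E * seed_law N [set w | S (releases x' w)] + delta%:E)%E.

Definition dynamic_error (R : realType) (X : choiceType) (Q : finType)
    (q : Q -> X -> R) (N : dynamic_mechanism R X Q) (x : stream X) (t : nat)
    (w : seed N) : R :=
  max_error (fun f => answer f [tuple releases x w i | i < t])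
            (fun f => query q f (dataset x t)).

(* Base-2 logarithm rounded up, read as at least 1. *)
Definition clog (n : nat) : nat := maxn 1 (up_log 2 n).

Definition error_bound (R : realType) (alpha : nat -> R -> R -> R -> nat -> R)
    (eps delta beta : R) (n t : nat) : R :=
  let m := (n + clog (clog t))%N in
  let L := clog m in
  alpha L (eps / L%:R) (delta / L%:R) beta n
    + eps^-1 * Num.max 1 (ln (t%:R / beta)).

(* Main.v *)
(* The stream is cut into segments. At each time the open segment is closed with
   a probability driven by a hazard exp(eps/2 (count - T_t)), where T_t is of
   order log(t / beta) / eps; the law of the decisions has a closed form, which
   makes it eps/2-private, and with high probability every closed segment is
   nonempty and the open one has at most 2 T_t items.

   The closed segments are summarised by static runs arranged in a binary
   counter. The number of levels 2^e must match log m_t, and no monotonicity of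
   the error function is available, so a new epoch, with fresh runs at privacy
   share 2^-(e+3), starts whenever the estimate of log m_t computed from the
   decisions crosses a power of two. Shares decrease geometrically in e, so one
   item pays at most eps/2 in total. In every epoch all levels are populated,
   by runs on the empty dataset if necessary, so that the number of runs is
   comparable with log m_t.

   Outputs are rounded to a grid, so that the transcripts of bounded length form
   a countable set. All transcripts are then read off one uniform variable by
   arithmetic coding, and privacy extends from prefixes to infinite sequences by
   approximating measurable sets by cylinders. *)

(* The size n_t is private, so the epoch may depend only on released decisions and on time: each
   closing stands for a number [gain t] of items fixed in advance, about half of T_t and at least
   one. Gains and true size agree up to a constant factor only with high probability and only once
   the gains reach T_t. Accuracy needs no more, while privacy holds for every sequence of decisions.
   Counting nonempty segments instead of time steps is what replaces log t by log n_t. Privacy of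
   the runs is proved with the decisions fixed: an item then belongs to one known segment, and the
   runs that contain it form a fixed list. The decisions themselves are purely private, so delta is
   spent on the runs alone. For accuracy, the number of runs, both privacy shares, the failure
   probability and the data size must each be within a factor 16 of the target, in both directions.
   Small gains would break this comparison, hence the separate answer 0 in that case. *)
Require Import Defs.
From mathcomp Require Import all_boot all_order all_algebra.
From mathcomp Require Import finmap multiset.
From mathcomp Require Import all_classical all_reals all_analysis.
From mathcomp Require Import ring lra zify.

Set Implicit Arguments.
Unset Strict Implicit.
Unset Printing Implicit Defensive.

Import Order.TTheory GRing.Theory Num.Theory.
Local Open Scope classical_set_scope.
Local Open Scope ring_scope.

(** * Sums over arbitrary types and the hockey-stick divergence *)

Section esum_extra.
Context {R : realType}.
Local Open Scope ereal_scope.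

Lemma esumZl (T : choiceType) (I : set T) (c : R) (a : T -> \bar R) :
  (0 <= c)%R -> (forall i, 0 <= a i) ->
  \esum_(i in I) (c%:E * a i) = c%:E * \esum_(i in I) a i.
Proof.
have le_esumZ (d : R) (b : T -> \bar R) : (0 <= d)%R -> (forall i, 0 <= b i) ->
    \esum_(i in I) (d%:E * b i) <= d%:E * \esum_(i in I) b i.
  move=> d0 b0; apply: ge_ereal_sup => _ [X IX <-].
  rewrite -ge0_mule_fsumr//; apply: lee_pmul => //.
    by apply: fsume_ge0.
  by apply: esum_ge; exists X.
move=> c0 a0; apply/eqP; rewrite eq_le le_esumZ//=.
have [->|cn0] := eqVneq c 0%R.
  by rewrite mul0e esum_ge0// => i _; rewrite mul0e.
have c_gt0 : (0 < c)%R by rewrite lt_def cn0.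
rewrite muleC -lee_pdivlMr//.
have := le_esumZ (c^-1)%R (fun i => c%:E * a i).
rewrite muleC; under eq_esum => i _ do rewrite muleA -EFinM mulVf// mul1e.
by apply; rewrite ?invr_ge0// => i; rewrite mule_ge0.
Qed.

Lemma esum_exchange (T1 T2 : choiceType) (a : T1 -> T2 -> \bar R) :
  (forall i j, 0 <= a i j) ->
  \esum_(i in setT) \esum_(j in setT) a i j =
  \esum_(j in setT) \esum_(i in setT) a i j.
Proof.
move=> a0; rewrite !esum_esum//.
rewrite (reindex_esum (setT `*`` fun=> setT) _ (fun x => (x.2, x.1)))//.
split=> //= [[i1 i2] [j1 j2] _ _ /= [-> ->] //|[i j] _].
by exists (j, i).
Qed.

Lemma esum_pair (T1 T2 : choiceType) (a : T1 * T2 -> \bar R) :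
  (forall i, 0 <= a i) ->
  \esum_(i in setT) a i = \esum_(i in setT) \esum_(j in setT) a (i, j).
Proof.
move=> a0; rewrite esum_esum//; congr esum; first by apply/seteqP; split.
by apply/funext => -[].
Qed.

Lemma esum_cons (T : choiceType) (a : seq T -> \bar R) :
  (forall i, 0 <= a i) ->
  \esum_(i in setT) a i =
  a [::] + \esum_(x in setT) \esum_(s in setT) a (x :: s).
Proof.
move=> a0; rewrite (esumID [set [::]])// setTI esum_set1//; congr (_ + _).
rewrite esum_esum//.
rewrite (reindex_esum (setT `*`` fun=> setT) _ (fun x => x.1 :: x.2))//.
split=> //= [[i1 i2] [j1 j2] _ _ /= [-> ->] //|[|x s] [_]].
  by move=> /(_ erefl).
by move=> _; exists (x, s).
Qed.

Lemma esum_bool (a : bool -> \bar R) : (forall c, 0 <= a c) ->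
  \esum_(c in setT) a c = a true + a false.
Proof.
move=> a0; rewrite (esumID [set true])// setTI esum_set1//; congr (_ + _).
have -> : ~` [set true] = [set false] 
  by apply/seteqP; split => -[] //=.
by rewrite setTI esum_set1.
Qed.

Lemma esum_point (T : choiceType) (x : T) (a : T -> \bar R) :
  (forall i, 0 <= a i) -> (forall i, i != x -> a i = 0) ->
  \esum_(i in setT) a i = a x.
Proof.
move=> a0 ax; rewrite (esumID [set x])// setTI esum_set1// esum1 ?adde0//.
by move=> i [_ /eqP]; exact: ax.
Qed.

Lemma le_esum_subset (T : choiceType) (I J : set T) (a : T -> \bar R) :
  (forall i, 0 <= a i) -> I `<=` J ->
  \esum_(i in I) a i <= \esum_(i in J) a i.
Proof.
move=> a0 IJ; rewrite esum_mkcond [leRHS]esum_mkcond; apply: le_esum => i _.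
case: ifPn => [/set_mem/IJ/mem_set ->//|_]; by case: ifP.
Qed.

(* [hockey_stick (expR eps) p p' <= delta] is (eps, delta)-indistinguishability
   (in one direction) of the discrete laws p and p'. *)
Definition hockey_stick (T : choiceType) (c : R) (p p' : T -> R) : \bar R :=
  \esum_(z in setT) (Num.max 0 (p z - c * p' z))%:E.

Lemma max0_ge0 (x : R) : (0 <= Num.max 0 x)%R.
Proof. by rewrite le_max lexx. Qed.

Lemma hockey_stick_self (T : choiceType) (p : T -> R) :
  hockey_stick 1 p p = 0.
Proof. by apply: esum1 => i _; rewrite mul1r subrr maxxx. Qed.

(** With m = min(a, c a'), the left side is at most a b - m d b' = (a - m) b + m (b - d b'). Here a
    - m is the positive part of a - c a', and 0 <= m <= a. *)
Lemma hockey_stick_comp_pointwise (a a' b b' c d : R) :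
  (0 <= a -> 0 <= b -> 0 <= b' -> 0 <= d -> 0 <= c * a' ->
  Num.max 0 (a * b - c * d * (a' * b')) <=
    Num.max 0 (a - c * a') * b + a * Num.max 0 (b - d * b'))%R.
Proof.
move=> a0 b0 b'0 d0 ca'0.
rewrite ge_max; apply/andP; split.
  by rewrite addr_ge0// mulr_ge0// max0_ge0.
have -> : (c * d * (a' * b') = (c * a') * (d * b'))%R by ring.
move: (c * a')%R ca'0 => e e0; have : (0 <= d * b')%R by rewrite mulr_ge0.
move: (d * b')%R => f f0.
rewrite !maxEle; case: (lerP 0 (a - e)%R) => h1; case: (lerP 0 (b - f)%R) => h2; nra.
Qed.

(** The second divergence is weighted by [a], of total mass at most 1, so the deltas add without a
    factor [c]. The second law may depend on the first outcome, which covers adaptive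
    composition. *)
Lemma hockey_stick_comp (T1 T2 : choiceType) (c d : R) (r1 r2 : \bar R)
    (a a' : T1 -> R) (b b' : T1 -> T2 -> R) :
  (0 <= c)%R -> (0 <= d)%R -> 0 <= r2 ->
  (forall i, 0 <= a i)%R -> (forall i, 0 <= a' i)%R ->
  (forall i j, 0 <= b i j)%R -> (forall i j, 0 <= b' i j)%R ->
  \esum_(i in setT) (a i)%:E <= 1 ->
  (forall i, \esum_(j in setT) (b i j)%:E <= 1) ->
  hockey_stick c a a' <= r1 -> (forall i, hockey_stick d (b i) (b' i) <= r2) ->
  \esum_(i in setT) \esum_(j in setT)
     (Num.max 0 (a i * b i j - c * d * (a' i * b' i j)))%:E <= r1 + r2.
Proof.
move=> c0 d0 r20 a0 a'0 b0 b'0 a1 b1 h1 h2.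
apply: (@le_trans _ _ (\esum_(i in setT)
   ((Num.max 0 (a i - c * a' i))%:E + (a i)%:E * r2))).
  apply: le_esum => i _; apply: (@le_trans _ _ (\esum_(j in setT)
   ((Num.max 0 (a i - c * a' i))%:E * (b i j)%:E +
    (a i)%:E * (Num.max 0 (b i j - d * b' i j))%:E))).
    apply: le_esum => j _; rewrite -!EFinM -EFinD lee_fin.
    by apply: hockey_stick_comp_pointwise => //; rewrite mulr_ge0.
  rewrite esumD; last 2 first.
  - by move=> j _; rewrite -EFinM lee_fin mulr_ge0// max0_ge0.
  - by move=> j _; rewrite -EFinM lee_fin mulr_ge0// max0_ge0.
  rewrite !esumZl ?max0_ge0//; last 2 first.
  - by move=> j; rewrite lee_fin ?max0_ge0.
  - by move=> j; rewrite lee_fin ?max0_ge0.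
  apply: leeD; last by rewrite lee_wpmul2l ?lee_fin//; exact: h2.
  by rewrite -[leRHS]mule1 lee_wpmul2l ?lee_fin ?max0_ge0.
rewrite esumD; last 2 first.
- by move=> i _; rewrite lee_fin max0_ge0.
- by move=> i _; rewrite mule_ge0 ?lee_fin.
apply: leeD => //.
under eq_esum do rewrite muleC.
case: r2 r20 {h2} => [r| |//] r0; last by rewrite leey.
rewrite esumZl// -?lee_fin//.
by rewrite -[leRHS]mule1 lee_wpmul2l.
Qed.

End esum_extra.

(** * Events of a countable-valued map *)

Section countable_preimage.
Context {R : realType} (d : measure_display) (T : measurableType d).
Context (Y : countType) (h : T -> Y).
Hypothesis measurable_h : forall y, measurable [set w | h w = y].

Let preimageE (A : set Y) : [set w | A (h w)] =
  \bigcup_(n in @choice.pickle Y @` A) [set w | choice.pickle (h w) = n].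
Proof.
apply/seteqP; split => w /=.
  by move=> Aw; exists (choice.pickle (h w)) => //; exists (h w).
by move=> [n [y Ay <-]] /= /(pcan_inj choice.pickleK) ->.
Qed.

Let pickleE y : [set w | choice.pickle (h w) = choice.pickle y] = [set w | h w = y].
Proof.
by apply/seteqP; split => w /=; [move/(pcan_inj choice.pickleK)|move->].
Qed.

Lemma measurable_countable_preimage A : measurable [set w | A (h w)].
Proof.
by rewrite preimageE; apply: bigcup_measurable => _ [y _ <-]; rewrite pickleE.
Qed.

Lemma measure_countable_preimage (mu : {measure set T -> \bar R}) A :
  mu [set w | A (h w)] = (\esum_(y in A) mu [set w | h w = y])%E.
Proof.
rewrite preimageE measure_bigcup; last 2 first.
- by move=> _ [y _ <-]; rewrite pickleE.
- by move=> i j _ _ [w [/= <- <-]].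
rewrite nneseries_esum; last by move=> n _; exact: measure_ge0.
rewrite (_ : [set x | x \in _] = @choice.pickle Y @` A); last first.
  by apply/seteqP; split => n; rewrite /= inE.
rewrite esum_image; last by move=> x y _ _; exact: (pcan_inj choice.pickleK).
by apply: eq_esum => y _; rewrite pickleE.
Qed.

End countable_preimage.

(** * Arithmetic coding of transcripts by one uniform variable *)

Section coding.
Context {R : realType}.

Definition unit_uniform : probability (measurableTypeR R) R :=
  uniform_prob (@ltr01 R).

Lemma unit_uniform_itvco (a b : R) : 0 <= a -> a <= b -> b <= 1 ->
  unit_uniform `[a, b[%classic = (b - a)%:E.
Proof.
move=> a0 ab b1; rewrite /unit_uniform /= /uniform_prob integral_uniform_pdf.
rewrite setIidl; last first.
  move=> x /=; rewrite !in_itv/= => /andP[ax xb].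
  by rewrite (le_trans a0)//= (le_trans (ltW xb)).
rewrite (eq_integral (fun=> 1%:E)); last first.
  move=> x; rewrite inE/= in_itv/= /uniform_pdf => /andP[ax xb].
  by rewrite (le_trans a0)//= (le_trans (ltW xb))// subr0 invr1.
rewrite integral_cst//= mul1e lebesgue_measure_itv/= lte_fin.
by case: ifPn => [//|]; rewrite -leNgt => ba; rewrite (le_anti (introT andP (conj ab ba))) subrr.
Qed.

Lemma unit_uniform_outside : unit_uniform (~` `[0, 1[%classic) = 0.
Proof.
rewrite probability_setC// unit_uniform_itvco// subr0.
by rewrite subee.
Qed.

Context (I : Type) (Y : countType) (y0 : Y) (p : seq I -> seq Y -> R).
Hypothesis p_ge0 : forall s ys, 0 <= p s ys.
Hypothesis p_nil : p [::] [::] = 1.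
Hypothesis p_cons : forall a s ys, size ys = size s ->
  (\esum_(y in setT) (p (a :: s) (y :: ys))%:E = (p s ys)%:E)%E.

(** Outputs are ordered by their codes; a number that codes no output gets an interval of length
    0. *)
Let child a s ys n : R :=
  if pickle_inv n is Some y then p (a :: s) (y :: ys) else 0.

Let child_ge0 a s ys n : 0 <= child a s ys n.
Proof. by rewrite /child; case: pickle_inv. Qed.

(* Arithmetic coding: the transcripts compatible with an input history s cut
   [0, 1[ into intervals of length p s ys, and appending an input and an output
   subdivides the interval. A point of [0, 1[ thus picks a transcript for every
   history at once, consistently along prefixes. Histories are newest first. *)
Fixpoint cell_start (s : seq I) (ys : seq Y) : R :=
  match s, ys with
  | a :: s', y :: ys' =>
      cell_start s' ys' + \sum_(0 <= j < choice.pickle y) child a s' ys' j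
  | _, _ => 0
  end.

Definition cell s ys : set R :=
  `[cell_start s ys, cell_start s ys + p s ys[%classic.

Let child_series a s ys : size ys = size s ->
  (\sum_(n <oo) (child a s ys n)%:E = (p s ys)%:E)%E.
Proof.
move=> sz; rewrite nneseries_esumT; last by move=> n; rewrite lee_fin.
rewrite -(p_cons a sz) (esumID (@choice.pickle Y @` setT)); last first.
  by move=> n _; rewrite lee_fin.
rewrite [X in (_ + X)%E]esum1 ?adde0; last first.
  move=> n [_ nY]; rewrite /child; case: (pickle_inv n) (@pickle_invK Y n) => //= y yn.
  by exfalso; apply: nY; exists y.
rewrite setTI esum_image; last by move=> x y _ _; exact: (pcan_inj choice.pickleK).
by apply: eq_esum => y _; rewrite /child pickleK_inv.
Qed.

Let child_sum_le a s ys n : size ys = size s ->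
  \sum_(0 <= j < n) child a s ys j <= p s ys.
Proof.
move=> sz; rewrite -lee_fin -(child_series a sz) -sumEFin.
by apply: nneseries_lim_ge => i _; rewrite lee_fin.
Qed.

Let cell_child a s y ys :
  cell_start (a :: s) (y :: ys) + p (a :: s) (y :: ys) =
  cell_start s ys + \sum_(0 <= j < (choice.pickle y).+1) child a s ys j.
Proof. by rewrite big_nat_recr//= {3}/child pickleK_inv addrA. Qed.

Let cell_sub a s y ys : size ys = size s ->
  cell (a :: s) (y :: ys) `<=` cell s ys.
Proof.
move=> sz w; rewrite /cell cell_child /= !in_itv/= => /andP[h1 h2].
rewrite (le_trans _ h1)/= ?lerDl ?sumr_ge0//.
by rewrite (lt_le_trans h2)// lerD2l child_sum_le.
Qed.

Let cell_cover a s ys w : size ys = size s -> cell s ys w ->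
  exists y, cell (a :: s) (y :: ys) w.
Proof.
move=> sz; rewrite /cell /= in_itv/= => /andP[h1 h2].
(* The least partial sum exceeding [w] identifies the child. Its last summand is nonzero, so its
   index is the code of an output. *)
have /ex_minnP[] : exists n,
    w < cell_start s ys + \sum_(0 <= j < n) child a s ys j.
  apply/not_existsP => H; suff : p s ys <= w - cell_start s ys by lra.
  rewrite -lee_fin -(child_series a sz); apply: lime_le.
    by apply: is_cvg_nneseries => n _ _; rewrite lee_fin.
  apply: nearW => n; rewrite sumEFin lee_fin.
  by have /negP := H n; rewrite -leNgt; lra.
case=> [|k wk kmin]; first by rewrite big_geq// addr0; lra.
have kw : cell_start s ys + \sum_(0 <= j < k) child a s ys j <= w.
  by rewrite leNgt; apply/negP => /kmin; rewrite ltnn.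
have : child a s ys k != 0.
  apply/eqP => ck; move: wk; rewrite big_nat_recr//= ck addr0; lra.
rewrite /child; case E : (pickle_inv k) => [y|]; last by rewrite eqxx.
have yk : choice.pickle y = k by have := @pickle_invK Y k; rewrite E.
move=> _; exists y; rewrite cell_child /= in_itv/=.
by move: kw wk; rewrite -{}yk => kw wk; apply/andP; split.
Qed.

Let cell_uniq a s y y' ys w :
  cell (a :: s) (y :: ys) w -> cell (a :: s) (y' :: ys) w -> y = y'.
Proof.
wlog : y y' / (choice.pickle y < choice.pickle y')%N => [H h h'|lt_yy'].
  case: (ltngtP (choice.pickle y) (choice.pickle y')) => [?|?|/(pcan_inj choice.pickleK)//].
    exact: H.
  by apply/esym; exact: H.
rewrite /cell cell_child /= !in_itv/= => /andP[_ +] /andP[+ _].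
rewrite (big_cat_nat (leq0n _) lt_yy')/=.
move=> wlt lew; have := le_lt_trans lew wlt.
by rewrite ltrD2l gtrDl ltNge sumr_ge0.
Qed.

(** On the unit interval exactly one child cell contains [w], so [xget] has no freedom. Outside it
    no cell does and [y0] is repeated, on a set of measure 0. *)
Fixpoint decode (s : seq I) (w : R) : seq Y :=
  if s is a :: s' then
    let ys := decode s' w in
    xget y0 [set y | cell (a :: s') (y :: ys) w] :: ys
  else [::].

Lemma size_decode s w : size (decode s w) = size s.
Proof. by elim: s => //= a s ->. Qed.

Let cell_decode s w : `[0, 1[%classic w -> cell s (decode s w) w.
Proof.
move=> w01; elim: s => [|a s IH]; first by rewrite /cell /= p_nil add0r.
have [y cy] := cell_cover a (size_decode s w) IH.
exact: (xgetPex y0 (P := [set y | cell (a :: s) (y :: decode s w) w])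
  (ex_intro _ y cy)).
Qed.

Let cell_unit s ys : size ys = size s -> cell s ys `<=` `[0, 1[%classic.
Proof.
elim: s ys => [|a s IH] [|y ys]//=.
  by move=> _; rewrite /cell /= p_nil add0r.
by move=> [sz]; apply: subset_trans (IH _ sz); exact: cell_sub.
Qed.

Let decode_cell s ys w : size ys = size s -> cell s ys w -> decode s w = ys.
Proof.
elim: s ys => [|a s IH] [|y ys]//= [sz] cw.
rewrite (IH ys sz); last exact: cell_sub cw.
congr (_ :: _); apply: (cell_uniq _ cw).
exact: (xgetPex y0 (P := [set y | cell (a :: s) (y :: ys) w])
  (ex_intro _ y cw)).
Qed.

Let decode_out s w : ~ `[0, 1[%classic w -> decode s w = nseq (size s) y0.
Proof.
move=> w01; elim: s => //= a s ->; rewrite xgetPN// => y /cell_unit h.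
by apply: w01; apply: h => /=; rewrite size_nseq.
Qed.

Let decode_preimage s ys : size ys = size s ->
  [set w | decode s w = ys] =
  cell s ys `|` (if ys == nseq (size s) y0 then ~` `[0, 1[%classic else set0).
Proof.
move=> sz; apply/seteqP; split => w /=.
  move=> <-; have [w01|w01] := pselect (`[0, 1[%classic w).
    by left; exact: cell_decode.
  by right; rewrite decode_out// eqxx.
case; first exact: decode_cell.
by case: eqP => [->|//] w01; exact: decode_out.
Qed.

Lemma measurable_decode s ys : measurable [set w | decode s w = ys].
Proof.
have [sz|sz] := eqVneq (size ys) (size s); last first.
  rewrite (_ : [set _ | _] = set0)//; apply/seteqP; split => w //= h.
  by move: sz; rewrite -h size_decode eqxx.
rewrite decode_preimage//; apply: measurableU; first exact: measurable_itv.
by case: ifP => // _; apply: measurableC; exact: measurable_itv.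
Qed.

Let cell_start_ge0 s ys : 0 <= cell_start s ys.
Proof.
by elim: s ys => [|a s IH] [|y ys]//=; rewrite addr_ge0// sumr_ge0.
Qed.

Lemma decode_law s ys : size ys = size s ->
  unit_uniform [set w | decode s w = ys] = (p s ys)%:E.
Proof.
move=> sz; rewrite decode_preimage// measureU//; last 3 first.
- exact: measurable_itv.
- by case: ifP => // _; apply: measurableC; exact: measurable_itv.
- apply/seteqP; split => // w [/(cell_unit sz) w01].
  by case: ifP.
rewrite [X in (_ + X)%E](_ : _ = 0%E) ?adde0; last first.
  by case: ifP => _; [exact: unit_uniform_outside|exact: measure0].
apply: etrans.
  apply: unit_uniform_itvco; rewrite ?lerDl//.
  elim: s ys sz => [|a s IH] [|y ys]//=.
    by move=> _; rewrite p_nil add0r.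
  move=> [sz]; rewrite cell_child (le_trans _ (IH _ sz))// lerD2l.
  exact: child_sum_le.
by rewrite addrAC subrr add0r.
Qed.

Hypothesis p_size : forall s ys, size ys != size s -> p s ys = 0.

Lemma decode_law_in s (A : set (seq Y)) :
  unit_uniform [set w | A (decode s w)] = (\esum_(ys in A) (p s ys)%:E)%E.
Proof.
rewrite [LHS](@measure_countable_preimage R _ (measurableTypeR R) _ _
  (measurable_decode s) unit_uniform A).
apply: eq_esum => ys _; have [sz|sz] := eqVneq (size ys) (size s).
  exact: decode_law.
rewrite p_size// (_ : [set _ | _] = set0) ?measure0//.
apply/seteqP; split => // w /= h.
by move: sz; rewrite -h size_decode eqxx.
Qed.

End coding.

(** * Products of discrete laws *)

Section product_pmf.
Context {R : realType} {Z : choiceType}.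
Local Open Scope ereal_scope.

Definition pmf (T : choiceType) (f : T -> R) : Prop :=
  (forall z, (0 <= f z)%R) /\ \esum_(z in setT) (f z)%:E = 1.

Fixpoint prod_pmf (k : nat) (f : nat -> Z -> R) (zs : seq Z) : R :=
  match k, zs with
  | 0, [::] => 1
  | j.+1, z :: zs' => (f 0%N z * prod_pmf j (fun i => f i.+1) zs')%R
  | _, _ => 0
  end.

Definition point_pmf (T : eqType) (x z : T) : R := (z == x)%:R.

Lemma pmf_point (x : Z) : pmf (point_pmf x).
Proof.
split=> [z|]; first by rewrite ler0n.
rewrite (@esum_point _ _ x); first by rewrite /point_pmf eqxx.
  by move=> i; rewrite lee_fin ler0n.
by move=> i /negbTE ix; rewrite /point_pmf ix.
Qed.

Lemma prod_pmf_ge0 k f zs : (forall i z, (0 <= f i z)%R) -> (0 <= prod_pmf k f zs)%R.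
Proof.
by elim: k f zs => [|k IH] f [|z zs]//= f0; rewrite mulr_ge0// IH.
Qed.

Lemma prod_pmf_size k f zs : prod_pmf k f zs != 0%R -> size zs = k.
Proof.
elim: k f zs => [|k IH] f [|z zs]//=; rewrite ?eqxx// mulf_eq0 negb_or.
by move=> /andP[_ /IH ->].
Qed.

Lemma eq_prod_pmf k f g zs : (forall i, (i < k)%N -> f i = g i) ->
  prod_pmf k f zs = prod_pmf k g zs.
Proof.
elim: k f g zs => [|k IH] f g [|z zs]//= fg; rewrite fg//; congr (_ * _)%R.
by apply: IH => i ik; exact: fg.
Qed.

Lemma pmf_prod k f : (forall i, pmf (f i)) -> pmf (prod_pmf k f).
Proof.
move=> pf; have f0 i z : (0 <= f i z)%R by case: (pf i).
split=> [zs|]; first exact: prod_pmf_ge0.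
elim: k f pf f0 => [|k IH] f pf f0.
  rewrite (@esum_point _ _ [::])//.
    by move=> zs; rewrite lee_fin prod_pmf_ge0.
  by case.
rewrite esum_cons; last by move=> zs; rewrite lee_fin prod_pmf_ge0.
rewrite add0e -[RHS](pf 0%N).2; apply: eq_esum => z _.
under eq_esum do rewrite /= EFinM.
rewrite esumZl// ?IH ?mule1//.
by move=> zs; rewrite lee_fin prod_pmf_ge0.
Qed.

(** Coordinates with equal laws can take [u i = 0], so only the runs that contain the differing item
    are charged. *)
Lemma hockey_stick_prod k (eps delta : R) (u : nat -> R) (f f' : nat -> Z -> R) :
  (0 <= delta)%R -> (forall i, (0 <= u i)%R) ->
  (forall i, pmf (f i)) -> (forall i, pmf (f' i)) ->
  (forall i, hockey_stick (expR (eps * u i)) (f i) (f' i) <= (delta * u i)%:E) ->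
  hockey_stick (expR (eps * \sum_(i < k) u i)%R) (prod_pmf k f) (prod_pmf k f')
    <= (delta * \sum_(i < k) u i)%:E.
Proof.
move=> d0; elim: k u f f' => [|k IH] u f f' u0 pf pf' H.
  rewrite big_ord0 !mulr0 expR0 (_ : prod_pmf 0 f = prod_pmf 0 f').
    by rewrite hockey_stick_self.
  by apply/funext => -[].
have f0 i z : (0 <= f i z)%R by case: (pf i).
have f'0 i z : (0 <= f' i z)%R by case: (pf' i).
rewrite /hockey_stick esum_cons; last by move=> zs; rewrite lee_fin max0_ge0.
rewrite /= mulr0 subr0 maxxx add0e big_ord_recl /= !mulrDr expRD EFinD.
apply: hockey_stick_comp => //; rewrite ?expR_ge0//.
- by rewrite lee_fin mulr_ge0// sumr_ge0.
- by move=> _ zs; exact: prod_pmf_ge0.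
- by move=> _ zs; exact: prod_pmf_ge0.
- by rewrite (pf 0%N).2.
- by move=> _; rewrite (pmf_prod k (fun i => pf i.+1)).2.
- by move=> _; apply: (IH (u \o S)) => [i|i|i|i] /=; [exact: u0|exact: pf|exact: pf'|exact: H].
Qed.

End product_pmf.

(** * Expectations under discrete laws *)

Section mean.
Context {R : realType}.
Local Open Scope ereal_scope.

Definition mean (T : choiceType) (p : T -> R) (F : T -> \bar R) : \bar R :=
  \esum_(z in setT) ((p z)%:E * F z).

Lemma mean_ge0 (T : choiceType) (p : T -> R) F :
  pmf p -> (forall z, 0 <= F z) -> 0 <= mean p F.
Proof.
by move=> [p0 _] F0; apply: esum_ge0 => z _; rewrite mule_ge0// lee_fin.
Qed.

Lemma eq_mean (T : choiceType) (p : T -> R) F G :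
  (forall z, p z != 0%R -> F z = G z) -> mean p F = mean p G.
Proof.
move=> FG; apply: eq_esum => z _.
by have [->|/FG ->//] := eqVneq (p z) 0%R; rewrite !mul0e.
Qed.

Lemma le_mean (T : choiceType) (p : T -> R) F G : pmf p ->
  (forall z, p z != 0%R -> F z <= G z) -> mean p F <= mean p G.
Proof.
move=> [p0 _] FG; apply: le_esum => z _.
have [->|/FG h] := eqVneq (p z) 0%R; first by rewrite !mul0e.
by rewrite lee_wpmul2l ?lee_fin.
Qed.

Lemma mean_cst (T : choiceType) (p : T -> R) (c : \bar R) :
  pmf p -> 0 <= c -> mean p (fun=> c) = c.
Proof.
move=> [p0 p1]; rewrite /mean; case: c => [c| |//] c0.
  by under eq_esum do rewrite muleC; rewrite esumZl ?lee_fin// ?p1 ?mule1.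
have [z pz] : exists z, p z != 0%R.
  apply/not_existsP => h; move: p1; rewrite esum1.
    by move=> /eqP; rewrite eq_sym onee_eq0.
  by move=> z _; have /negP/negbNE/eqP -> := h z.
apply/eqP; rewrite eq_le leey/=.
apply: (@le_trans _ _ (\esum_(x in [set z]) ((p x)%:E * +oo))); last first.
  by apply: le_esum_subset => // x; rewrite mule_ge0 ?lee_fin ?leey.
rewrite esum_set1 ?mule_ge0 ?lee_fin ?leey//.
by rewrite gt0_muley// lte_fin lt_def pz p0.
Qed.

Lemma mean_point (T : choiceType) (x : T) F :
  (forall z, 0 <= F z) -> mean (point_pmf x) F = F x.
Proof.
move=> F0; rewrite /mean (@esum_point _ _ x).
- by rewrite /point_pmf eqxx mul1e.
- by move=> z; rewrite mule_ge0// lee_fin ler0n.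
- by move=> z /negbTE zx; rewrite /point_pmf zx mul0e.
Qed.

Lemma mean_swap (T1 T2 : choiceType) (p : T1 -> R) (q : T2 -> R) F :
  pmf p -> pmf q -> (forall x y, 0 <= F x y) ->
  mean p (fun x => mean q (F x)) = mean q (fun y => mean p (F ^~ y)).
Proof.
move=> [p0 p1] [q0 q1] F0; rewrite /mean.
have pq0 x y : 0 <= (q y)%:E * F x y by rewrite mule_ge0 ?lee_fin.
have qp0 x y : 0 <= (p x)%:E * F x y by rewrite mule_ge0 ?lee_fin.
under eq_esum do rewrite -esumZl//.
rewrite esum_exchange; last by move=> *; rewrite mule_ge0 ?lee_fin.
apply: eq_esum => y _; rewrite -esumZl//.
by apply: eq_esum => x _; rewrite muleCA.
Qed.

Lemma mean_prod (Z : choiceType) k (f : nat -> Z -> R) F :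
  (forall i, pmf (f i)) -> (forall zs, 0 <= F zs) ->
  mean (prod_pmf k.+1 f) F =
  mean (f 0%N) (fun z => mean (prod_pmf k (fun i => f i.+1)) (F \o cons z)).
Proof.
move=> pf F0; have f0 i z : (0 <= f i z)%R by case: (pf i).
rewrite /mean esum_cons; last first.
  by move=> zs; rewrite mule_ge0// lee_fin; exact: prod_pmf_ge0.
rewrite mul0e add0e; apply: eq_esum => z _.
rewrite -esumZl//; last first.
  move=> zs; apply: mule_ge0; last exact: F0.
  by rewrite lee_fin; exact: prod_pmf_ge0.
by apply: eq_esum => zs _; rewrite /= EFinM muleA.
Qed.

(** The choice [r] of coordinates to redraw does not look at their values, so the vector remains
    independent. This is one step of a counter whose levels are renewed at different times. *)
Lemma mean_prod_refresh (Z : choiceType) k (z0 : Z) (r : nat -> bool)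
    (f q : nat -> Z -> R) (F : seq Z -> \bar R) :
  (forall i, pmf (f i)) -> (forall i, pmf (q i)) -> (forall zs, 0 <= F zs) ->
  mean (prod_pmf k f) (fun ys => mean (prod_pmf k
    (fun i => if r i then q i else point_pmf (nth z0 ys i))) F) =
  mean (prod_pmf k (fun i => if r i then q i else f i)) F.
Proof.
elim: k r f q F => [|k IH] r f q F pf pq F0.
  have p0 g : prod_pmf 0 g = point_pmf [::] :> (seq Z -> R).
    by apply/funext => -[].
  rewrite !p0 mean_point ?p0// => ys.
  by rewrite mean_ge0// p0; exact: pmf_point.
have pg ys i : pmf (if r i then q i else point_pmf (nth z0 ys i)).
  by case: ifP => // _; exact: pmf_point.
have ph i : pmf (if r i then q i else f i) by case: ifP.
have mg n (g : nat -> Z -> R) G : (forall i, pmf (g i)) ->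
    (forall zs, 0 <= G zs) -> 0 <= mean (prod_pmf n g) G.
  by move=> pg' G0; apply: mean_ge0 => //; exact: pmf_prod.
rewrite mean_prod//; last by move=> ys; exact: mg.
rewrite [RHS]mean_prod//.
pose H z := mean (prod_pmf k (fun i => if r i.+1 then q i.+1 else f i.+1))
  (F \o cons z).
have H0 z : 0 <= H z by apply: mg => // *; exact: F0.
transitivity (mean (f 0%N) (fun y =>
    mean (if r 0%N then q 0%N else point_pmf y) H)).
  apply: eq_mean => y _; rewrite /comp.
  (* The new coordinate 0 is moved outside the remaining old coordinates, where the induction
     hypothesis applies. *)
  under eq_mean do rewrite mean_prod//=.
  rewrite mean_swap; last 3 first.
  - exact: pmf_prod.
  - exact: (pg [:: y] 0%N).
  - move=> ys z; apply: mg => [i|zs]; last exact: F0.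
    exact: (pg (y :: ys) i.+1).
  apply: eq_mean => z _.
  by apply: (IH (r \o S) (f \o S) (q \o S)) => [i|i|zs] /=.
case: (r 0%N); first by rewrite mean_cst//; exact: mean_ge0.
by apply: eq_mean => y _; rewrite mean_point.
Qed.

End mean.

(** * From finite prefixes to events on infinite sequences *)

Section sequence_events.
Context {R : realType} (d : measure_display) (T : measurableType d).
Context (P : probability T R) (G : bool -> nat -> T -> nat) (tr : nat -> nat).
(** A release determines all earlier ones, so a condition on finitely many releases is a condition
    on a single one. *)
Hypothesis G_tr : forall b n w, G b n w = tr (G b n.+1 w).
Hypothesis measurable_G : forall b n A, measurable [set w | A (G b n w)].
Local Open Scope ereal_scope.

Let pre b (S : set (nat -> nat)) : set T := [set w | S (G b ^~ w)].

Let cyl b n (A : set nat) : set T := [set w | A (G b n w)].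

(** The same cylinder must serve both streams, since the privacy inequality compares one event under
    two laws. *)
Let approximable (S : set (nat -> nat)) : Prop :=
  (forall b, measurable (pre b S)) /\
  forall e : R, (0 < e)%R -> exists n A, forall b,
    P (pre b S `\` cyl b n A) <= e%:E /\ P (cyl b n A `\` pre b S) <= e%:E.

Let G_iter b n k w : G b n w = iter k tr (G b (k + n)%N w).
Proof. by elim: k => // k IH; rewrite iterSr addSn -G_tr. Qed.

Let approximableU S1 S2 :
  approximable S1 -> approximable S2 -> approximable (S1 `|` S2).
Proof.
move=> [mS1 a1] [mS2 a2]; split=> [b|e e0].
  exact: (measurableU _ _ (mS1 b) (mS2 b)).
have e20 : (0 < e / 2)%R by rewrite divr_gt0.
have [n1 [A1 h1]] := a1 _ e20; have [n2 [A2 h2]] := a2 _ e20.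
(* Both cylinders are read off at a common later time. *)
exists (n1 + n2)%N, [set m | A1 (iter n2 tr m) \/ A2 (iter n1 tr m)] => b.
have -> : cyl b (n1 + n2) [set m | A1 (iter n2 tr m) \/ A2 (iter n1 tr m)] =
    cyl b n1 A1 `|` cyl b n2 A2.
  apply/seteqP; split => w; rewrite /cyl /= (G_iter b n1 n2) (G_iter b n2 n1);
    by rewrite (addnC n2).
have mc n A : measurable (cyl b n A) by exact: measurable_G.
have le2 X1 X2 Y : measurable X1 -> measurable X2 -> measurable Y ->
    Y `<=` X1 `|` X2 -> P X1 <= (e / 2)%:E -> P X2 <= (e / 2)%:E ->
    P Y <= e%:E.
  move=> mX1 mX2 mY sub p1 p2.
  rewrite (splitr e) EFinD; apply: (le_trans _ (leeD p1 p2)).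
  apply: (le_trans _ (measureU2 P mX1 mX2)).
  by apply: le_measure; rewrite ?inE//; exact: measurableU.
have [p1 q1] := h1 b; have [p2 q2] := h2 b; split.
- apply: (le2 _ _ _ _ _ _ _ p1 p2); try by apply: measurableD.
    by apply: measurableD; apply: measurableU => //; [exact: mS1|exact: mS2].
  move=> w [[] h /not_orP[c1 c2]]; [left|right]; by split.
- apply: (le2 _ _ _ _ _ _ _ q1 q2); try by apply: measurableD.
    apply: measurableD; apply: measurableU => //; [exact: mS1|exact: mS2].
  move=> w [[] h /not_orP[c1 c2]]; [left|right]; by split.
Qed.

Let approximable0 : approximable set0.
Proof.
split=> [b|e e0]; first exact: measurable0.
exists 0%N, set0 => b.
rewrite (_ : pre b set0 = set0)// (_ : cyl b 0 set0 = set0)// setDv measure0.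
by rewrite lee_fin ltW.
Qed.

Let approximableC S : approximable S -> approximable (setT `\` S).
Proof.
have preC b S' : pre b (setT `\` S') = ~` pre b S'.
  by apply/seteqP; split => w; rewrite /pre /= => // -[].
have DC (X Y : set T) : ~` X `\` ~` Y = Y `\` X.
  by rewrite !setDE setCK setIC.
move=> [mS a]; split=> [b|e e0]; first by rewrite preC; exact/measurableC.
have [n [A h]] := a _ e0; exists n, (~` A) => b; have [p q] := h b.
by rewrite preC (_ : cyl b n (~` A) = ~` cyl b n A)// !DC.
Qed.

(** Continuity from below gives a finite union within [e / 2] for both streams at once, which is
    then approximated within [e / 2]. *)
Let approximable_bigcup (S : (set (nat -> nat))^nat) :
  (forall k, approximable (S k)) -> approximable (\bigcup_k S k).
Proof.
move=> aS; pose U N := \big[setU/set0]_(k < N) S k.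
have aU N : approximable (U N).
  rewrite /U; elim: N => [|N IH]; first by rewrite big_ord0.
  by rewrite big_ord_recr; exact: approximableU.
have preE b : pre b (\bigcup_k S k) = \bigcup_N pre b (U N).
  apply/seteqP; split => w.
    move=> [k _ Skw]; exists k.+1 => //=; rewrite /pre /U /= big_ord_recr.
    by right.
  move=> [N _]; rewrite /pre /U /= -bigcup_mkord => -[k /= kN Sk].
  by exists k.
have mU b : measurable (pre b (\bigcup_k S k)).
  by rewrite preE; apply: bigcup_measurable => N _; have [] := aU N.
split=> // e e0; have e20 : (0 < e / 2)%R by rewrite divr_gt0.
have small b : \forall N \near \oo,
    P (pre b (\bigcup_k S k) `\` pre b (U N)) <= (e / 2)%:E.
  have mUN N : measurable (pre b (U N)) by have [] := aU N.
  have : P (pre b (U N)) @[N --> \oo] --> P (pre b (\bigcup_k S k)).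
    rewrite preE; apply: nondecreasing_cvg_mu => //.
      by rewrite -preE.
    move=> N M NM; apply/subsetPset => w; rewrite /pre /U /= -!bigcup_mkord.
    by move=> [k /= kN Sk]; exists k => //=; exact: leq_trans NM.
  rewrite -[X in _ --> X]fineK ?fin_num_measure//.
  move=> /fine_cvgP[_ /cvgrPdist_le/(_ _ e20)].
  apply: filterS => N; rewrite measureD//; last first.
    by rewrite ltey_eq fin_num_measure.
  rewrite (_ : _ `&` _ = pre b (U N)); last first.
    by apply: setIidr; rewrite preE; exact: (bigcup_sup (i := N)).
  rewrite ler_norml => /andP[_ h].
  by rewrite -lee_fin EFinB !fineK ?fin_num_measure// in h.
have [N [/(_ _ (leqnn N)) N1 /(_ _ (leqnn N)) N2]] :
    exists N, (forall n, (N <= n)%N ->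
        P (pre true (\bigcup_k S k) `\` pre true (U n)) <= (e / 2)%:E) /\
      (forall n, (N <= n)%N ->
        P (pre false (\bigcup_k S k) `\` pre false (U n)) <= (e / 2)%:E).
  have [N1 _ h1] := small true; have [N2 _ h2] := small false.
  exists (maxn N1 N2); split=> n; rewrite geq_max => /andP[n1 n2].
    exact: h1.
  exact: h2.
have [_ /(_ _ e20)[n [A h]]] := aU N.
exists n, A => b; have [p q] := h b.
have mUN : measurable (pre b (U N)) by have [] := aU N.
have mc : measurable (cyl b n A) by exact: measurable_G.
have pb : P (pre b (\bigcup_k S k) `\` pre b (U N)) <= (e / 2)%:E by case: b {p q mUN mc h}.
split.
  rewrite (splitr e) EFinD; apply: (le_trans _ (leeD pb p)).
  apply: (le_trans _ (measureU2 P _ _)); try exact: measurableD.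
  apply: le_measure; rewrite ?inE; try exact: measurableD.
    by apply: measurableU; exact: measurableD.
  move=> w [Sw Aw]; have [Uw|Uw] := pselect (pre b (U N) w).
    by right; split.
  by left; split.
apply: (@le_trans _ _ (e / 2)%:E); last first.
  by rewrite lee_fin ler_pdivrMr//; lra.
apply: (le_trans _ q); apply: le_measure; rewrite ?inE; try exact: measurableD.
move=> w [Aw Sw]; split => // Uw; apply: Sw; rewrite preE.
by exists N.
Qed.

Let approximable_seq S : seq_measurable S -> approximable S.
Proof.
apply: smallest_sub; first by split.
move=> _ [i _ [B mB <-]]; have pE b :
    pre b ((setT `&` (fun y : nat -> nat => y i) @^-1` B)) = cyl b i B.
  by rewrite setTI.
split=> [b|e e0]; first by rewrite pE; exact: measurable_G.
exists i, B => b.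
by rewrite pE setDv measure0 lee_fin ltW.
Qed.

Lemma seq_event_indistinguishable (c delta : R) : (0 <= c)%R ->
  (forall n A, P [set w | A (G true n w)] <=
     c%:E * P [set w | A (G false n w)] + delta%:E) ->
  forall S, seq_measurable S ->
  P [set w | S (G true ^~ w)] <= c%:E * P [set w | S (G false ^~ w)] + delta%:E.
Proof.
move=> c0 H S /approximable_seq[mS aS].
apply/lee_addgt0Pr => e e0.
(* The approximation error enters once for [true] and [c] times for [false]. *)
have e'0 : (0 < e / (c + 1))%R by rewrite divr_gt0// ltr_wpDl.
have [n [A h]] := aS _ e'0.
have mc b : measurable (cyl b n A) by exact: measurable_G.
have le1 (X Y : set T) (r : R) : measurable X -> measurable Y -> P (X `\` Y) <= r%:E ->
    P X <= P Y + r%:E.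
  move=> mX mY p; apply: (le_trans _ (leeD2l _ p)).
  apply: (le_trans _ (measureU2 P mY (measurableD mX mY))).
  apply: le_measure; rewrite ?inE//; first by apply: measurableU => //; exact: measurableD.
  by move=> w Xw; have [Yw|Yw] := pselect (Y w); [left|right; split].
have [p _] := h true; have [_ q] := h false.
have p' := le1 _ _ _ (mS true) (mc true) p.
have q' := le1 _ _ _ (mc false) (mS false) q.
apply: (le_trans p').
apply: (@le_trans _ _ (c%:E * (P (pre false S) + (e / (c + 1))%:E) + delta%:E + (e / (c + 1))%:E)).
  rewrite leeD2r//; apply: (le_trans (H n A)); rewrite leeD2r//.
  by rewrite lee_wpmul2l ?lee_fin.
have [r Pr] : exists r, P (pre false S) = r%:E.
  by exists (fine (P (pre false S))); rewrite fineK// fin_num_measure.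
rewrite -/(pre false S) Pr.
rewrite -?EFinM -?EFinD -?EFinM -?EFinD lee_fin.
have : (e = c * (e / (c + 1)) + e / (c + 1))%R.
  by field; rewrite gt_eqF// ltr_wpDl.
by move: (e / (c + 1))%R => x ->; lra.
Qed.

End sequence_events.

(** * Epochs, the binary counter and the privacy cost of a segment *)

Section epochs.
Variable gain : nat -> nat.
Hypothesis gain_gt0 : forall t, (0 < gain t)%N.

Local Open Scope nat_scope.

(* b lists the decisions to close a segment, newest first; closing at time t
   certifies gain t new items. *)
Fixpoint gains (b : seq bool) : nat :=
  if b is c :: b' then c * gain (size b') + gains b' else 0.

Definition epoch (b : seq bool) : nat :=
  up_log 2 (clog (gains b + clog (clog (size b)))).

(** The first disjunct makes time 1 the start of an epoch, so no level ever has to repeat an output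
    that does not exist. *)
Definition renew (b : seq bool) : bool :=
  (behead b == [::]) || (epoch b != epoch (behead b)).

(* The number of segments closed when the current epoch started. *)
Fixpoint base (b : seq bool) : nat :=
  if b is _ :: b' then if renew b then count id b else base b' else 0.

(* Level l summarises the closed segments in [cut l.+1, cut l). Counting
   segments from the start of the epoch, cut l is the number of closed segments
   with its low l binary digits cleared; the last level covers all earlier
   epochs. *)
Definition cut (b : seq bool) (l : nat) : nat :=
  if l <= 2 ^ epoch b
  then base b + (count id b - base b) %/ 2 ^ l * 2 ^ l else 0.

Definition in_level (b : seq bool) (l sg : nat) : bool :=
  cut b l.+1 <= sg < cut b l.

Definition refresh (b : seq bool) (l : nat) : bool :=
  [|| renew b, cut b l != cut (behead b) l | cut b l.+1 != cut (behead b) l.+1].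

Definition levels (b : seq bool) : nat := (2 ^ epoch b).+1.

Lemma leq_clog m n : m <= n -> clog m <= clog n.
Proof. by move=> mn; rewrite /clog geq_max leq_maxl leq_max leq_up_log ?orbT. Qed.

Lemma clog_gt0 n : 0 < clog n.
Proof. by rewrite leq_maxl. Qed.

Lemma leq_exp_clog n : n <= 2 ^ clog n.
Proof.
apply: (leq_trans (up_logP n (ltnSn 1))).
by rewrite leq_exp2l// leq_maxr.
Qed.

Lemma epoch_cons c b : epoch b <= epoch (c :: b).
Proof.
apply: leq_up_log; apply: leq_clog; apply: leq_add; first exact: leq_addl.
by apply/leq_clog/leq_clog; rewrite /=.
Qed.

Lemma count_le_gains b : count id b <= gains b.
Proof.
elim: b => //= c b IH; apply: leq_add => //.
by case: c => //; rewrite mul1n gain_gt0.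
Qed.

(** Every closing certifies at least one item, so a counter with [2 ^ epoch b] binary digits cannot
    overflow. *)
Lemma count_lt_levels b : count id b < 2 ^ 2 ^ epoch b.
Proof.
apply: (@leq_trans (gains b + clog (clog (size b)))).
  by rewrite -addn1 leq_add ?count_le_gains ?clog_gt0.
apply: (leq_trans (leq_exp_clog _)).
by rewrite leq_exp2l// up_logP.
Qed.

Lemma base_le b : base b <= count id b.
Proof.
elim: b => //= c b IH; case: ifP => // _.
by apply: leq_trans IH _; rewrite leq_addl.
Qed.

Lemma cut_le b l : cut b l <= count id b.
Proof.
rewrite /cut; case: ifP => // _.
by apply: (leq_trans (leq_add (leqnn _) (leq_trunc_div _ _))); rewrite subnKC ?base_le.
Qed.

Lemma cut0 b : cut b 0 = count id b.
Proof. by rewrite /cut leq0n expn0 divn1 muln1 subnKC ?base_le. Qed.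

Lemma cut_last b : cut b (levels b) = 0.
Proof. by rewrite /cut /levels ltnn. Qed.

Lemma cut_top b : cut b (2 ^ epoch b) = base b.
Proof.
rewrite /cut leqnn divn_small ?addn0//.
by apply: leq_ltn_trans (leq_subr _ _) (count_lt_levels b).
Qed.

Lemma cut_anti b l : cut b l.+1 <= cut b l.
Proof.
rewrite /cut; case: ifP => // lt_l; rewrite (ltnW lt_l) leq_add2l expnSr.
by rewrite divnMA [(2 ^ l * 2)%N]mulnC mulnA leq_mul2r leq_trunc_div orbT.
Qed.

Lemma in_level_count b l sg : in_level b l sg -> sg < count id b.
Proof. by move=> /andP[_ h]; apply: leq_trans h (cut_le _ _). Qed.

(** The levels are consecutive intervals from [cut b 0], the number of closed segments, down to
    [cut b (levels b) = 0]. *)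
Lemma sum_in_level b sg :
  \sum_(l < levels b) in_level b l sg = (sg < count id b).
Proof.
have H n : \sum_(l < n) in_level b l sg = (cut b n <= sg < count id b).
  elim: n => [|n IH].
    by rewrite big_ord0 cut0 ltnNge; case: leqP.
  rewrite big_ord_recr /= IH /in_level; have := cut_anti b n; have := cut_le b n.
  by move: (cut b n) (cut b n.+1) (count id b) => x y z; lia.
by rewrite H cut_last.
Qed.

(** The comparison of quotients says that the dyadic block of length [2 ^ l] containing [sg] is
    complete. A segment at level [l] lies in a complete block. If the block was complete before and
    [sg] is in the level now, neither cut of the level has moved, so there is no refresh. Within an
    epoch, level [l] thus charges [sg] at most once, when its block is completed. *)
Lemma refresh_level_le c b l sg : ~~ renew (c :: b) -> l < 2 ^ epoch b ->
  base b <= sg ->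
  refresh (c :: b) l && in_level (c :: b) l sg +
    ((sg - base b) %/ 2 ^ l < (count id b - base b) %/ 2 ^ l) <=
  ((sg - base b) %/ 2 ^ l < (count id (c :: b) - base b) %/ 2 ^ l).
Proof.
move=> nr lb bsg; have baseE : base (c :: b) = base b by rewrite /= (negbTE nr).
have epochE : epoch (c :: b) = epoch b.
  by move: nr; rewrite /renew negb_or => /andP[_ /negPn/eqP].
have b_le := base_le b; have b'_le := base_le (c :: b); rewrite baseE in b'_le.
rewrite /refresh (negbTE nr) /in_level /cut baseE epochE lb (ltnW lb) /=.
rewrite expnSr !divnMA [(2 ^ l * 2)%N]mulnC.
set q := 2 ^ l; have q0 : 0 < q by rewrite expn_gt0.
have : count id b <= c + count id b <= (count id b).+1.
  by rewrite leq_addl -add1n leq_add2r leq_b1.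
rewrite /= in b'_le.
move: (c + count id b) b'_le => N' b'_le /andP[NN' N'N].
rewrite -(subnKC bsg); move: (sg - base b) => s.
rewrite -(subnKC b_le) -(subnKC b'_le) in NN' N'N *.
move: (N' - base b) (count id b - base b) NN' N'N => j' j.
rewrite -addnS !leq_add2l !ltn_add2l !eqn_add2l !addKn => jj' j'j.
rewrite !mulnA !eqn_pmul2r// -ltn_divLR// -leq_divRL//.
have jq : j %/ q <= j' %/ q by exact: leq_div2r.
have j'q : j' %/ q <= (j %/ q).+1.
  apply: (@leq_trans ((j + q) %/ q)); first by apply: leq_div2r; lia.
  by rewrite divnDr// divnn q0 addn1.
move: (j %/ q) (j' %/ q) (s %/ q) jq j'q => v v' w; lia.
Qed.


Section cost.
Context {R : realType}.
Local Open Scope ring_scope.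

Definition share (e : nat) : R := (2 ^- (e + 3)).

Lemma share_gt0 e : 0 < share e.
Proof. by rewrite invr_gt0 exprn_gt0. Qed.

Definition step_cost (sg : nat) (b : seq bool) (l : nat) : R :=
  (refresh b l && in_level b l sg)%:R * share (epoch b).

Fixpoint cost (sg : nat) (b : seq bool) : R :=
  if b is _ :: b' then cost sg b' + \sum_(l < levels b) step_cost sg b l else 0.

(* In its own epoch a segment enters one run per level, which costs at most
   2 ^ e * share e = 1 / 8; in each later epoch it enters only the bottom run,
   which costs share e, and these sum up to at most 1 / 4 - share e. *)
Lemma cost_invariant sg b :
  (cost sg b <= if (base b <= sg)%N
    then share (epoch b) *
      \sum_(l < 2 ^ epoch b)
        ((sg - base b) %/ 2 ^ l < (count id b - base b) %/ 2 ^ l)%N%:R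
    else 3 / 8 - share (epoch b)) /\ ((count id b <= sg)%N -> cost sg b = 0).
Proof.
elim: b => [|c b [IH IH0]].
  split=> //=; rewrite mulr_ge0 ?sumr_ge0// ltW// share_gt0//.
have share_le e : share e <= 1 / 8.
  rewrite /share exprD invfM (_ : 2 ^+ 3 = 8 :> R) ?ler_pM2r//; last by ring.
  by rewrite invf_le1 ?exprn_gt0// exprn_ege1// ler1n.
have zero : (count id (c :: b) <= sg)%N -> cost sg (c :: b) = 0.
  move=> le_sg; rewrite [LHS]/= IH0; last by apply: leq_trans le_sg; rewrite /= leq_addl.
  rewrite add0r big1// => l _; rewrite /step_cost.
  case: (boolP (in_level _ _ _)) => [/in_level_count|]; last by rewrite andbF mul0r.
  by rewrite ltnNge le_sg.
split=> //.
have [renb|nr] := boolP (renew (c :: b)).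
  have baseE : base (c :: b) = count id (c :: b) by rewrite [LHS]/= renb.
  rewrite baseE; case: leqP => [le_sg|lt_sg].
    by rewrite zero// mulr_ge0 ?sumr_ge0// ltW// share_gt0.
  (* A renewal reruns every level, but the segment lies in just one of them. *)
  have -> : cost sg (c :: b) = cost sg b + share (epoch (c :: b)).
    rewrite [LHS]/=; congr (_ + _); rewrite /step_cost -mulr_suml.
    under eq_bigr do rewrite {1}/refresh renb /=.
    by rewrite -natr_sum sum_in_level lt_sg mul1r.
  have [->|b0] := eqVneq b [::].
    have := share_le (epoch [:: c]); rewrite /=; lra.
  (* The new share is at most half the old one, so the reserve [share (epoch b)] covers both the new
     charge and the new reserve. *)
  have lt_e : (epoch b < epoch (c :: b))%N.
    rewrite ltn_neqAle epoch_cons andbT.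
    by move: renb; rewrite /renew /= (negbTE b0) eq_sym.
  have share2 : 2 * share (epoch (c :: b)) <= share (epoch b).
    rewrite /share -(subnKC lt_e) !addSn exprS invfM mulrA mulfV ?pnatr_eq0// mul1r.
    by rewrite lef_pV2 ?posrE ?exprn_gt0// ler_weXn2l ?ler1n// leq_add2r leq_addr.
  have := share_le (epoch (c :: b)).
  move: IH; case: leqP => _ IH; last by lra.
  have : \sum_(l < 2 ^ epoch b)
        ((sg - base b) %/ 2 ^ l < (count id b - base b) %/ 2 ^ l)%N%:R
      <= 2 ^+ epoch b :> R.
    apply: (@le_trans _ _ (\sum_(l < 2 ^ epoch b) 1)).
      by apply: ler_sum => l _; rewrite lern1 leq_b1.
    by rewrite sumr_const card_ord natrX.
  move=> /(ler_wpM2l (ltW (share_gt0 (epoch b)))).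
  have -> : share (epoch b) * 2 ^+ epoch b = 1 / 8.
    rewrite /share exprD invfM (_ : 2 ^+ 3 = 8 :> R); last by ring.
    by rewrite mulrAC mulVf ?expf_neq0// mul1r.
  by move: IH; set S := _ * _; lra.
have baseE : base (c :: b) = base b by rewrite /= (negbTE nr).
have epochE : epoch (c :: b) = epoch b.
  by move: nr; rewrite /renew negb_or => /andP[_ /negPn/eqP].
rewrite baseE epochE; move: IH; rewrite [cost sg (c :: b)]/=.
rewrite /step_cost /levels epochE -mulr_suml.
have le_cut l : (l <= 2 ^ epoch b)%N -> (base b <= cut (c :: b) l)%N.
  by move=> le_l; rewrite /cut epochE le_l baseE leq_addr.
case: leqP => [le_sg|lt_sg] IH; last first.
  (* A segment of an earlier epoch can only be in the bottom level, whose cuts [base] and 0 stay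
     fixed until the next renewal. *)
  rewrite big1 ?mul0r ?addr0// => l _; rewrite /in_level.
  have [lt_l|ge_l] := ltnP l (2 ^ epoch b).
    by rewrite [(_ <= sg)%N]leqNgt (leq_trans lt_sg (le_cut _ lt_l)) andbF.
  have -> : l = (2 ^ epoch b)%N :> nat.
    by apply/eqP; rewrite eqn_leq ge_l andbT -ltnS.
  rewrite /refresh (negbTE nr) /=.
  rewrite -{1}epochE cut_top cut_top baseE eqxx /=.
  by rewrite -{1}epochE cut_last cut_last.
have topE : cut (c :: b) (2 ^ epoch b) = base b.
  by rewrite -baseE -cut_top epochE.
rewrite big_ord_recr /= {2}/in_level topE.
rewrite [(sg < _)%N]ltnNge le_sg !andbF addr0.
apply: (le_trans (lerD IH (lexx _))).
rewrite [X in _ + X]mulrC -mulrDr ler_pM2l ?share_gt0// -big_split /=.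
apply: ler_sum => l _; rewrite -natrD ler_nat addnC.
exact: refresh_level_le.
Qed.

Lemma cost_ge0 sg b : 0 <= cost sg b.
Proof.
elim: b => //= c b IH; rewrite addr_ge0// sumr_ge0// => l _.
by rewrite mulr_ge0// ltW// share_gt0.
Qed.

Lemma cost_le_half sg b : cost sg b <= 1 / 2.
Proof.
have [+ _] := cost_invariant sg b; have := share_gt0 (epoch b).
case: ifP => _; last by lra.
have : \sum_(l < 2 ^ epoch b)
      ((sg - base b) %/ 2 ^ l < (count id b - base b) %/ 2 ^ l)%N%:R
    <= 2 ^+ epoch b :> R.
  apply: (@le_trans _ _ (\sum_(l < 2 ^ epoch b) 1)).
    by apply: ler_sum => l _; rewrite lern1 leq_b1.
  by rewrite sumr_const card_ord natrX.
move=> + sh0 => /(ler_wpM2l (ltW sh0)).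
have -> : share (epoch b) * 2 ^+ epoch b = 1 / 8.
  rewrite /share exprD invfM (_ : 2 ^+ 3 = 8 :> R); last by ring.
  by rewrite mulrAC mulVf ?expf_neq0// mul1r.
by set S := _ * _; lra.
Qed.

End cost.
End epochs.

(** * The law of the closing decisions and its privacy *)

Section closing_bits.
Context {R : realType} {X : Type}.
Variables (eta : R) (thr : nat -> R).

(** An item arriving at a closing time belongs to the segment being closed, hence the reset to 0. *)
Fixpoint pend (s : seq (option X)) (b : seq bool) : nat :=
  match s, b with
  | a :: s', c :: b' => if c then 0 else (pend s' b' + a)%N
  | _, _ => 0%N
  end.

Fixpoint covered (s : seq (option X)) (b : seq bool) : nat :=
  match s, b with
  | a :: s', c :: b' => (if c then covered s' b' + (pend s' b' + a) else covered s' b')%N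
  | _, _ => 0%N
  end.

Lemma covered_pend s b : size b = size s ->
  (covered s b + pend s b = count isSome s)%N.
Proof.
elim: s b => [|a s IH] [|c b]//= [sz]; have := IH b sz.
by case: c; lia.
Qed.

Definition hazard (a : option X) (s : seq (option X)) (b : seq bool) : R :=
  expR (eta * ((pend s b + a)%N%:R - thr (size b))).

Fixpoint potential (s : seq (option X)) (b : seq bool) : R :=
  match s, b with
  | a :: s', c :: b' => if c then 0 else potential s' b' + hazard a s' b'
  | _, _ => 0
  end.

(* A segment in which no decision to close was taken survives with probability
   1 / (1 + S), where S is the sum of the hazards. One more item multiplies
   hazards by at most expR eta, hence changes 1 + S, and the probability
   y / ((1 + S) (1 + S + y)) of closing at a given time, by at most this
   factor. *)
Definition bit_prob (a : option X) s b (c : bool) : R :=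
  let y := hazard a s b in let S := potential s b in
  (if c then y else 1 + S) / (1 + S + y).

Fixpoint bits_law (s : seq (option X)) (b : seq bool) : R :=
  match s, b with
  | [::], [::] => 1
  | a :: s', c :: b' => bits_law s' b' * bit_prob a s' b' c
  | _, _ => 0
  end.

Lemma hazard_gt0 a s b : 0 < hazard a s b.
Proof. exact: expR_gt0. Qed.

Lemma potential_ge0 s b : 0 <= potential s b.
Proof.
elim: s b => [|a s IH] [|c b]//=; case: c => //.
by rewrite addr_ge0// ltW// hazard_gt0.
Qed.

Lemma bit_prob_ge0 a s b c : 0 <= bit_prob a s b c.
Proof.
have := hazard_gt0 a s b; have := potential_ge0 s b; rewrite /bit_prob => ? ?.
by rewrite divr_ge0//; [case: c|]; lra.
Qed.

Lemma bit_prob_sum a s b : bit_prob a s b true + bit_prob a s b false = 1.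
Proof.
have := hazard_gt0 a s b; have := potential_ge0 s b; rewrite /bit_prob => ? ?.
by field; lra.
Qed.

Lemma bits_law_ge0 s b : 0 <= bits_law s b.
Proof.
by elim: s b => [|a s IH] [|c b]//=; rewrite mulr_ge0 ?bit_prob_ge0.
Qed.

Lemma bits_law_size s b : bits_law s b != 0 -> size b = size s.
Proof.
elim: s b => [|a s IH] [|c b]//=; rewrite ?eqxx// mulf_eq0 negb_or.
by move=> /andP[/IH ->].
Qed.

Lemma pmf_bits s : pmf (bits_law s).
Proof.
split; first exact: bits_law_ge0.
elim: s => [|a s IH].
  rewrite (@esum_point _ _ [::])//; last by case.
  by move=> b; rewrite lee_fin bits_law_ge0.
rewrite esum_cons; last by move=> b; rewrite lee_fin bits_law_ge0.
rewrite add0e esum_exchange; last first.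
  by move=> c b; rewrite lee_fin (bits_law_ge0 (a :: s) (c :: b)).
rewrite -IH; apply: eq_esum => b _ /=.
rewrite esum_bool; last first.
  by move=> c; rewrite lee_fin mulr_ge0 ?bits_law_ge0 ?bit_prob_ge0.
by rewrite -EFinD -mulrDr bit_prob_sum mulr1.
Qed.

(* The probability of the decisions up to the start of the open segment. *)
Definition start_weight s b : R := bits_law s b * (1 + potential s b).

Lemma start_weight_ge0 s b : 0 <= start_weight s b.
Proof. by rewrite mulr_ge0 ?bits_law_ge0 ?addr_ge0 ?potential_ge0. Qed.

(** Survival multiplies the law by (1 + S) / (1 + S + y), and [1 + potential] by the inverse
    ratio. *)
Lemma start_weight_false a s b :
  start_weight (a :: s) (false :: b) = start_weight s b.
Proof.
have := hazard_gt0 a s b; have := potential_ge0 s b.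
by rewrite /start_weight /= /bit_prob => ? ?; field; lra.
Qed.

Lemma start_weight_true a s b :
  start_weight (a :: s) (true :: b) = bits_law (a :: s) (true :: b).
Proof. by rewrite /start_weight /= addr0 mulr1. Qed.

(** There are [(size s).+1] possible starts of the open segment, each of probability at most 1. In
    the induction, survival keeps the old weights and closing adds at most the total mass of the
    law. *)
Lemma esum_start_weight s :
  (\esum_(b in setT) (start_weight s b)%:E <= (size s).+1%:R%:E)%E.
Proof.
elim: s => [|a s IH].
  rewrite (@esum_point _ _ [::]).
  - by rewrite /start_weight /= addr0 mulr1.
  - by move=> b; rewrite lee_fin start_weight_ge0.
  - by case=> // c b _; rewrite /start_weight /= mul0r.
rewrite esum_cons; last by move=> b; rewrite lee_fin start_weight_ge0.
rewrite {1}/start_weight /= mul0r add0e.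
rewrite esum_exchange; last by move=> c b; rewrite lee_fin start_weight_ge0.
apply: (@le_trans _ _ (\esum_(b in setT)
    ((start_weight s b)%:E + (bits_law s b)%:E))%E).
  apply: le_esum => b _.
  rewrite esum_bool; last by move=> c; rewrite lee_fin start_weight_ge0.
  rewrite start_weight_true start_weight_false -!EFinD lee_fin addrC lerD2l /=.
  rewrite ler_piMr ?bits_law_ge0//.
  by rewrite -(bit_prob_sum a s b) lerDl bit_prob_ge0.
rewrite esumD; last 2 first.
- by move=> b _; rewrite lee_fin start_weight_ge0.
- by move=> b _; rewrite lee_fin bits_law_ge0.
by rewrite (pmf_bits s).2 -(natr1 (size s).+1) EFinD leeD2r.
Qed.

Section privacy.
Hypothesis eta_ge0 : 0 <= eta.
Variables (s2 : seq (option X)) (x : X).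
Let old s1 : seq (option X) := s1 ++ None :: s2.
Let new s1 : seq (option X) := s1 ++ Some x :: s2.
Let e := expR eta.

Let e_ge1 : 1 <= e.
Proof. by rewrite -expR0 ler_expR. Qed.

(** Passing from (S, y) to (S', e y) lowers the weight of the open segment by a factor at most e and
    raises the closing probability by a factor at most e. The two changes oppose each other, so the
    product loses e and not its square. *)
Let frac_le (A S S' y : R) : 0 <= A -> 0 <= S -> 0 < y -> S <= S' <= e * S ->
  let W := A / (1 + S) in let W' := A / (1 + S') in
  [/\ W <= e * W', W' <= e * W,
      W * (y / (1 + S + y)) <= e * (W' * (e * y / (1 + S' + e * y))) &
      W' * (e * y / (1 + S' + e * y)) <= e * (W * (y / (1 + S + y)))].
Proof.
move=> A0 S0 y0 /andP[SS' S'S] W W'.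
have e1 := e_ge1.
have le_ey : y <= e * y by rewrite ler_peMl// ltW.
have eS : S' <= e * S by [].
have S'0 : 0 <= S' by lra.
have W'W : W' <= W by rewrite /W /W' ler_wpM2l// lef_pV2 ?posrE; lra.
have WW' : W <= e * W'.
  rewrite /W /W' mulrCA ler_wpM2l// -[X in _ <= X * _]invrK -invfM.
  rewrite lef_pV2 ?posrE; [|lra|by rewrite mulr_gt0 ?invr_gt0; lra].
  by rewrite ler_pdivrMl; lra.
have W0 : 0 <= W by rewrite divr_ge0; lra.
have W'0 : 0 <= W' by rewrite divr_ge0; lra.
set q := y / (1 + S + y); set q' := e * y / (1 + S' + e * y).
have q0 : 0 <= q by rewrite divr_ge0; lra.
have q'0 : 0 <= q' by rewrite divr_ge0; lra.
have qq' : q <= q'.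
  rewrite /q /q' ler_pdivrMr; last by lra.
  rewrite mulrAC ler_pdivlMr; last by lra.
  rewrite mulrC; nra.
have q'q : q' <= e * q.
  rewrite /q /q' mulrA ler_wpM2l//; first by lra.
  by rewrite lef_pV2 ?posrE; lra.
split=> //.
- by apply: (le_trans W'W); rewrite ler_peMl.
- by rewrite [X in _ <= X]mulrA ler_pM.
- by rewrite [X in _ <= X]mulrCA ler_pM.
Qed.

(* Before the segment of the extra item is closed, the two histories have the
   same start weight; afterwards they evolve identically. *)
Let phase_step (a a' : option X) s s' b c :
    (pend s' b + a' = (pend s b + a).+1)%N ->
    potential s b <= potential s' b <= e * potential s b ->
    start_weight s' b = start_weight s b ->
  if c
  then [/\ pend (a' :: s') (c :: b) = pend (a :: s) (c :: b),
           potential (a' :: s') (c :: b) = potential (a :: s) (c :: b),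
           bits_law (a' :: s') (c :: b) <= e * bits_law (a :: s) (c :: b) &
           bits_law (a :: s) (c :: b) <= e * bits_law (a' :: s') (c :: b)]
  else [/\ pend (a' :: s') (c :: b) = (pend (a :: s) (c :: b)).+1,
           potential (a :: s) (c :: b) <= potential (a' :: s') (c :: b)
             <= e * potential (a :: s) (c :: b) &
           start_weight (a' :: s') (c :: b) = start_weight (a :: s) (c :: b)].
Proof.
move=> pendE potE wE.
have hazE : hazard a' s' b = e * hazard a s b.
  by rewrite /hazard pendE -expRD -natr1; congr expR; ring.
have := @frac_le (start_weight s b) (potential s b) (potential s' b)
  (hazard a s b) (start_weight_ge0 _ _) (potential_ge0 _ _) (hazard_gt0 _ _ _) potE.
have S0 := potential_ge0 s b; have S'0 := potential_ge0 s' b.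
have WE : start_weight s b / (1 + potential s b) = bits_law s b.
  by rewrite mulfK// gt_eqF// ltr_pwDl.
have WE' : start_weight s b / (1 + potential s' b) = bits_law s' b.
  by rewrite -wE mulfK// gt_eqF// ltr_pwDl.
cbv zeta; rewrite WE WE' -hazE => -[h1 h2 h3 h4].
case: c; first by split.
split; [by []| |by rewrite !start_weight_false].
move=> {pendE}; have e1 := e_ge1; have y0 := hazard_gt0 a s b.
have : hazard a s b <= e * hazard a s b by rewrite ler_peMl// ltW.
by move: potE => /andP[? ?] /= ?; rewrite hazE mulrDr; apply/andP; split; lra.
Qed.

(** The first [(size s1).+1] decisions are those taken from the arrival of the extra item on. A
    closing among them ends its influence. *)
Let phases s1 b : size b = (size s1 + size s2)%N.+1 ->
  if has id (take (size s1).+1 b)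
  then [/\ pend (new s1) b = pend (old s1) b,
           potential (new s1) b = potential (old s1) b,
           bits_law (new s1) b <= e * bits_law (old s1) b &
           bits_law (old s1) b <= e * bits_law (new s1) b]
  else [/\ pend (new s1) b = (pend (old s1) b).+1,
           potential (old s1) b <= potential (new s1) b <= e * potential (old s1) b &
           start_weight (new s1) b = start_weight (old s1) b].
Proof.
elim: s1 b => [|a s1 IH] [|c b]//= [sz].
  have := @phase_step None (Some x) s2 s2 b c.
  rewrite take0 /= orbF addn0 addn1; apply=> //.
  by rewrite lexx ler_peMl ?potential_ge0.
have := IH b sz; case: ifP => _.
  move=> [pE SE h1 h2]; rewrite orbT.
  rewrite /bit_prob /hazard pE SE; split=> //.
    by rewrite [X in _ <= X]mulrA ler_wpM2r// divr_ge0//;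
      [case: c|]; rewrite ?addr_ge0 ?expR_ge0 ?potential_ge0.
  by rewrite [X in _ <= X]mulrA ler_wpM2r// divr_ge0//;
      [case: c|]; rewrite ?addr_ge0 ?expR_ge0 ?potential_ge0.
rewrite orbF => -[pE SE wE].
by apply: phase_step => //; rewrite pE.
Qed.

Lemma bits_privacy s1 b :
  bits_law (old s1) b <= e * bits_law (new s1) b /\
  bits_law (new s1) b <= e * bits_law (old s1) b.
Proof.
have szE : size (old s1) = size (new s1) by rewrite !size_cat.
have [sz|nsz] := eqVneq (size b) (size (old s1)); last first.
  have -> : bits_law (old s1) b = 0.
    by apply/eqP; apply: contraNT nsz => /bits_law_size/eqP.
  have -> : bits_law (new s1) b = 0.
    by apply/eqP; apply: contraNT nsz => /bits_law_size/eqP; rewrite szE.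
  by rewrite mulr0.
rewrite size_cat /= addnS in sz; have := phases sz; case: ifP => _ []//.
move=> _ SE wE.
have S0 := potential_ge0 (old s1) b; have S'0 := potential_ge0 (new s1) b.
(* No closing is compared here: only the first two bounds matter, and the hazard 1 is a
   placeholder. *)
have := @frac_le (start_weight (old s1) b) _ _ 1 (start_weight_ge0 _ _) S0 ltr01 SE.
have WE : start_weight (old s1) b / (1 + potential (old s1) b) = bits_law (old s1) b.
  by rewrite mulfK// gt_eqF// ltr_pwDl.
have WE' : start_weight (old s1) b / (1 + potential (new s1) b) = bits_law (new s1) b.
  by rewrite -wE mulfK// gt_eqF// ltr_pwDl.
by cbv zeta; rewrite WE WE'; case.
Qed.

End privacy.
End closing_bits.

(** * Closings that come neither too early nor too late *)

Section good_bits.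
Context {R : realType} {X : Type}.
Variables (thr : nat -> R).
Hypothesis thr_gt0 : forall n, 0 < thr n.

(** For large eps the truncation may be 0; with the maximum, a good closing still ensures a nonempty
    segment. *)
Definition min_gain (t : nat) : nat := maxn 1 (Num.truncn (thr t / 2)).

Lemma min_gain_gt0 t : (0 < min_gain t)%N.
Proof. by rewrite leq_maxl. Qed.

Definition good_bit (a : option X) (s : seq (option X)) b (c : bool) : bool :=
  if c then (min_gain (size b) <= pend s b + a)%N
  else (pend s b + a)%N%:R < 2 * thr (size b).

Fixpoint good (s : seq (option X)) (b : seq bool) : bool :=
  match s, b with
  | a :: s', c :: b' => good s' b' && good_bit a s' b' c
  | _, _ => true
  end.

Lemma good_bounds s b : (forall n, thr n <= thr n.+1) -> size b = size s -> good s b ->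
  [/\ (gains min_gain b <= covered s b)%N,
      (covered s b <= 9 * gains min_gain b)%N &
      (pend s b)%:R <= 2 * thr (size b)].
Proof.
move=> thr_mono; elim: s b => [|a s IH] [|c b]//=.
  by move=> _ _; split; rewrite // ?mulr_ge0 ?ltW// => *; exact: thr_gt0.
move=> [sz] /andP[/(IH b sz)[h1 h2 h3]].
have t0 := thr_gt0 (size b); have tm := thr_mono (size b).
rewrite /good_bit; case: c => /= gc; last first.
  split=> //; rewrite ?mul0n//; lra.
split; rewrite ?mul1n; last by rewrite mulr0n; lra.
  by rewrite addnC leq_add.
(* Since [thr / 2 < 2 * min_gain], the items already pending number at most 8 gains. The item
   arriving at the closing accounts for the ninth. *)
have : (pend s b <= 8 * min_gain (size b))%N.
  rewrite -(ler_nat R); apply: (le_trans h3).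
  have : thr (size b) / 2 < (2 * min_gain (size b))%N%:R.
    apply: (lt_le_trans (truncnS_gt _)); rewrite ler_nat /min_gain.
    by move: (Num.truncn _) => k; lia.
  rewrite !natrM; lra.
have : (a <= 1)%N by case: (a).
have := min_gain_gt0 (size b); lia.
Qed.

Variable eta : R.
Hypothesis eta_ge0 : 0 <= eta.

(** An early closing is unlikely after any history, its hazard being at most exp(- eta thr / 2). A
    late survival is not: once the potential is large, it may be likely given the history. Only its
    joint probability with the history is small, namely [start_weight] / (1 + S + y) with y >=
    exp(eta thr); hence the second weight. *)
Lemma bad_bit_prob a s b :
  \sum_(c : bool) (~~ good_bit a s b c)%:R * bits_law eta thr (a :: s) (c :: b) <=
  (bits_law eta thr s b + start_weight eta thr s b) * expR (- (eta * thr (size b) / 2)).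
Proof.
rewrite big_bool /= [X in _ <= X]mulrDl. apply: lerD.
  rewrite /good_bit; case: leqP => [_|lt_gain]; rewrite ?mul0r ?mul1r /=.
    by rewrite mulr_ge0 ?bits_law_ge0 ?expR_ge0.
  rewrite ler_wpM2l ?bits_law_ge0// /bit_prob.
  have S0 := potential_ge0 eta thr s b; have y0 := hazard_gt0 eta thr a s b.
  apply: (@le_trans _ _ (hazard eta thr a s b)).
    by rewrite ler_pdivrMr ?ler_peMr ?ltW//; lra.
  rewrite /hazard ler_expR -mulrA -mulrN ler_wpM2l//.
  have : (pend s b + a)%N%:R <= thr (size b) / 2.
    have T0 : 0 <= thr (size b) / 2 by rewrite divr_ge0 ?ltW.
    move: lt_gain; rewrite /min_gain leq_max !ltnS leqn0 => /orP[/eqP ->//|lt_gain].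
    have := truncn_le (thr (size b) / 2); rewrite T0 => /(le_trans _); apply.
    by rewrite ler_nat ltnW.
  lra.
rewrite /good_bit; case: ltP => [_|le_pend]; rewrite ?mul0r ?mul1r /=.
  by rewrite mulr_ge0 ?start_weight_ge0 ?expR_ge0.
have S0 := potential_ge0 eta thr s b; have y0 := hazard_gt0 eta thr a s b.
rewrite /bit_prob mulrA ler_wpM2l ?start_weight_ge0//.
apply: (@le_trans _ _ (hazard eta thr a s b)^-1).
  by rewrite lef_pV2 ?posrE; lra.
rewrite /hazard -expRN ler_expR lerN2 -mulrA ler_wpM2l//.
have := thr_gt0 (size b); lra.
Qed.

Variable beta : R.
(** The factor n + 2 bounds the mass 1 of [bits_law] plus the mass at most n + 1 of [start_weight].
    The right side telescopes, leaving at most beta / 2 in a union bound over time. *)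
Hypothesis thr_tail : forall n, n.+2%:R * expR (- (eta * thr n / 2)) <=
  beta / 2 * (n.+1%:R^-1 - n.+2%:R^-1).

Lemma bad_bits_prob s :
  (mean (bits_law eta thr s) (fun b => (~~ good s b)%:R%:E) <=
     (beta / 2 * (1 - (size s).+1%:R^-1))%:E)%E.
Proof.
have W0 := @bits_law_ge0 R X eta thr.
have A0 := @start_weight_ge0 R X eta thr.
have E0 := expR_ge0.
elim: s => [|a s IH].
  rewrite /mean esum1 ?lee_fin ?invr1 ?subrr ?mulr0// => b _.
  by rewrite mule0.
rewrite /mean esum_cons; last by move=> b; rewrite -EFinM lee_fin mulr_ge0.
rewrite mul0e add0e esum_exchange; last first.
  by move=> c b; rewrite -EFinM lee_fin mulr_ge0 ?(W0 (a :: s) (c :: b)).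
apply: (@le_trans _ _ (\esum_(b in setT) ((bits_law eta thr s b)%:E *
    (~~ good s b)%:R%:E + (expR (- (eta * thr (size s) / 2)))%:E *
   ((bits_law eta thr s b)%:E + (start_weight eta thr s b)%:E)))%E).
  apply: le_esum => b _; rewrite esum_bool; last first.
    by move=> c; rewrite -EFinM lee_fin mulr_ge0 ?(W0 (a :: s) (c :: b)).
  rewrite -!(EFinM, EFinD) lee_fin.
  have [sz|sz] := eqVneq (size b) (size s); last first.
    have Wb0 : bits_law eta thr s b = 0.
      by apply/eqP; apply: contraNT sz => /bits_law_size/eqP.
    rewrite /= Wb0 !(mul0r, mulr0, addr0, add0r).
    by rewrite mulr_ge0.
  have := bad_bit_prob a s b; rewrite big_bool sz.
  have goodE c : good (a :: s) (c :: b) = good s b && good_bit a s b c by [].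
  have lawE c : bits_law eta thr (a :: s) (c :: b) =
    bits_law eta thr s b * bit_prob eta thr a s b c by [].
  rewrite !goodE !lawE.
  have := bit_prob_sum eta thr a s b.
  have := bit_prob_ge0 eta thr a s b true.
  have := bit_prob_ge0 eta thr a s b false.
  have := W0 s b.
  move: (bit_prob _ _ _ _ _ true) (bit_prob _ _ _ _ _ false) => p q.
  move: (good_bit _ _ _ true) (good_bit _ _ _ false) => g1 g2.
  move: (bits_law _ _ _ _) (start_weight _ _ _ _) (expR _) => W A E W_ge0 q0 p0 pq.
  have Wp : 0 <= W * p by rewrite mulr_ge0.
  have Wq : 0 <= W * q by rewrite mulr_ge0.
  have WE : W = W * p + W * q by rewrite -mulrDr pq mulr1.
  rewrite [E * _]mulrC.
  case: (good s b); case: g1; case: g2;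
    rewrite /= ?(mulr0, mul0r, mulr1, mul1r, addr0, add0r); lra.
rewrite esumD; last 2 first.
- by move=> b _; rewrite -EFinM lee_fin mulr_ge0.
- by move=> b _; rewrite -EFinD -EFinM lee_fin mulr_ge0 ?addr_ge0.
rewrite esumZl//; last by move=> b; rewrite -EFinD lee_fin addr_ge0.
rewrite esumD; last 2 first.
- by move=> b _; rewrite lee_fin.
- by move=> b _; rewrite lee_fin.
rewrite (pmf_bits eta thr s).2.
apply: (@le_trans _ _ ((beta / 2 * (1 - (size s).+1%:R^-1))%:E +
  (expR (- (eta * thr (size s) / 2)))%:E * (1 + (size s).+1%:R%:E)))%E.
  apply: leeD; first exact: IH.
  rewrite lee_wpmul2l ?lee_fin// leeD2l//; exact: esum_start_weight.
rewrite -!(EFinD, EFinM) lee_fin /=.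
have := thr_tail (size s); rewrite nat1r [_ * (size s).+2%:R]mulrC.
move: (size s).+1%:R^-1 (size s).+2%:R^-1 (_ * expR _) (beta / 2) => u v w r.
rewrite !mulrBr; lra.
Qed.

End good_bits.

Section max_error_lemmas.
Context {R : realType} (Q : finType).

Lemma max_error_le (a b : Q -> R) (c : R) :
  0 <= c -> (forall f, `|a f - b f| <= c) -> max_error a b <= c.
Proof. by move=> c0 h; apply/bigmax_leP. Qed.

Lemma le_max_error (a b : Q -> R) f : `|a f - b f| <= max_error a b.
Proof. exact: (le_bigmax _ (fun f => `|a f - b f|)). Qed.

Lemma max_error_ge0 (a b : Q -> R) : 0 <= max_error a b.
Proof. by rewrite /max_error; elim/big_ind: _ => // x y x0 _; rewrite le_max x0. Qed.

End max_error_lemmas.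

(** * Rounding the static answers to a grid *)

Section discretisation.
Local Open Scope mset_scope.
Local Open Scope ring_scope.
Context {R : realType} {X : choiceType} {Q : finType}.
Variables (M : static_mechanism R X Q) (grid : R).
Hypothesis grid_gt0 : 0 < grid.

Notation Z := {ffun Q -> int}.

Definition rounded (y : static_out M) : Z :=
  [ffun f => Num.floor (static_answer f y / grid)].

Definition rounded_pmf (D : {mset X}) (z : Z) : R :=
  fine (static_law M D [set y | rounded y = z]).

Lemma measurable_rounded z : measurable [set y | rounded y = z].
Proof.
rewrite (_ : [set _ | _] = \bigcap_(f in [set: Q])
  (static_answer f @^-1` `[grid * (z f)%:~R, grid * (z f + 1)%:~R[%classic)).
  apply: fin_bigcap_measurable => // f _; rewrite -[X in measurable X]setTI.
  exact: measurable_static_answer.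
apply/seteqP; split => y /=.
  move=> <- f _ /=; rewrite in_itv /= ffunE.
  by rewrite -ler_pdivlMl// -ltr_pdivrMl// ![grid^-1 * _]mulrC floor_itv.
move=> h; apply/ffunP => f; rewrite ffunE; apply: floor_def.
by have := h f I; rewrite /= in_itv /= -ler_pdivlMl// -ltr_pdivrMl// ![grid^-1 * _]mulrC.
Qed.

Lemma rounded_pmfE D z :
  (rounded_pmf D z)%:E = static_law M D [set y | rounded y = z].
Proof. by rewrite fineK// fin_num_measure//; exact: measurable_rounded. Qed.

Lemma rounded_pmf_in D (A : set Z) :
  (\esum_(z in A) (rounded_pmf D z)%:E)%E = static_law M D [set y | A (rounded y)].
Proof.
rewrite measure_countable_preimage; last exact: measurable_rounded.
by apply: eq_esum => z _; rewrite rounded_pmfE.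
Qed.

Lemma pmf_rounded D : pmf (rounded_pmf D).
Proof.
split=> [z|]; first by rewrite fine_ge0.
by rewrite rounded_pmf_in (_ : [set _ | _] = setT) ?probability_setT.
Qed.

(** The divergence is attained on the event where the first law exceeds [expR eps] times the second,
    so privacy is applied to that single event. *)
Lemma rounded_pmf_DP (eps delta : R) (D D' : {mset X}) :
  static_DP eps delta M -> neighbor D D' ->
  (hockey_stick (expR eps) (rounded_pmf D) (rounded_pmf D') <= delta%:E)%E.
Proof.
move=> dp DD'; set c := expR eps.
have c0 : 0 <= c by exact: expR_ge0.
have [p0 p1] := pmf_rounded D; have [p'0 p'1] := pmf_rounded D'.
set A : set Z := [set z | c * rounded_pmf D' z < rounded_pmf D z].
have hsE : hockey_stick c (rounded_pmf D) (rounded_pmf D') =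
    (\esum_(z in A) (Num.max 0 (rounded_pmf D z - c * rounded_pmf D' z))%:E)%E.
  rewrite [RHS]esum_mkcond; apply: eq_esum => z _; case: ifPn => //.
  rewrite notin_setE /A /= => /negP; rewrite -leNgt => le_p.
  by congr EFin; apply/max_idPl; lra.
have mA : measurable [set y | A (rounded y)].
  by apply: measurable_countable_preimage; exact: measurable_rounded.
have := dp _ _ DD' _ mA; rewrite -!rounded_pmf_in.
have -> : (\esum_(z in A) (rounded_pmf D z)%:E =
    hockey_stick c (rounded_pmf D) (rounded_pmf D') +
    c%:E * \esum_(z in A) (rounded_pmf D' z)%:E)%E.
  rewrite hsE -esumZl//.
  rewrite -esumD; last 2 first.
  - by move=> z _; rewrite lee_fin max0_ge0.
  - by move=> z _; rewrite -EFinM lee_fin mulr_ge0.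
  apply: eq_esum => z /= zA; rewrite -EFinM -EFinD; congr EFin.
  by rewrite (max_idPr _) ?subrK// subr_ge0 ltW.
rewrite -/c addeC leeD2lE// fin_numM// ge0_fin_numE; last first.
  by apply: esum_ge0 => z _; rewrite lee_fin.
apply: (@le_lt_trans _ _ 1%E); last by rewrite ltry.
by rewrite -p'1; apply: le_esum_subset => // z; rewrite lee_fin.
Qed.

Definition grid_sum (k : nat) (zs : seq Z) (f : Q) : R :=
  \sum_(l < k) grid * ((nth [ffun=> 0] zs l) f)%:~R.

Lemma prod_pmfE (k : nat) (p : nat -> Z -> R) (zs : k.-tuple Z) :
  prod_pmf k p zs = \prod_(i < k) p i (tnth zs i).
Proof.
elim: k p zs => [|k IH] p zs; first by rewrite big_ord0 tuple0.
case/tupleP: zs => z zs; rewrite big_ord_recl /= tnth0. congr (_ * _).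
by rewrite (IH (fun i => p i.+1)); apply: eq_bigr => i _; rewrite tnthS.
Qed.

(** The fibres of [map rounded] are boxes, so [runs_box] turns the product measure into a product of
    discrete laws. *)
Lemma runs_rounded (k : nat) (D : nat -> {mset X}) (B : set (seq Z)) :
  (runs (fun i : 'I_k => static_law M (D i))
     [set y | B (map rounded y)] =
   \esum_(zs in B) (prod_pmf k (fun i => rounded_pmf (D i)) zs)%:E)%E /\
  measurable [set y : k.-tuple (static_out M) | B (map rounded y)].
Proof.
have box (zs : k.-tuple Z) : [set y : k.-tuple (static_out M) | map rounded y = zs] =
    [set y | forall i, [set y | rounded y = tnth zs i] (tnth y i)].
  apply/seteqP; split => y /=.
    move=> yz i; have <- : [tuple of map rounded y] = zs by exact/val_inj.
    by rewrite tnth_map.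
  move=> h; apply: (congr1 val (_ : [tuple of map rounded y] = zs)).
  by apply: eq_from_tnth => i; rewrite tnth_map.
have empty (zs : seq Z) : size zs != k ->
    [set y : k.-tuple (static_out M) | map rounded y = zs] = set0.
  move=> /eqP nsz; apply/seteqP; split => // y /= yz; apply: nsz.
  by rewrite -yz size_map size_tuple.
have meas (zs : seq Z) :
    measurable [set y : k.-tuple (static_out M) | map rounded y = zs].
  have [sz|/empty ->//] := eqVneq (size zs) k.
  have := box (Tuple (introT eqP sz)) => /= ->.
  rewrite (_ : [set _ | _] = \bigcap_(i in [set: 'I_k])
      ((fun y : k.-tuple (static_out M) => tnth y i) @^-1`
        [set y | rounded y = tnth (Tuple (introT eqP sz)) i])); last first.
    by apply/seteqP; split => y /= h i; [move=> _ |]; exact: h.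
  apply: fin_bigcap_measurable => // i _.
  rewrite -[X in measurable X]setTI; apply: measurable_tnth => //.
  exact: measurable_rounded.
split; last exact: measurable_countable_preimage.
rewrite (measure_countable_preimage meas); apply: eq_esum => zs _.
have [sz|nsz] := eqVneq (size zs) k; last first.
  rewrite empty// measure0; congr EFin; apply/esym/eqP; apply: contraNT nsz.
  by move=> /prod_pmf_size ->.
have := box (Tuple (introT eqP sz)) => /= ->.
rewrite (@runs_box _ _ _ _ _ (fun i => [set y | rounded y =
  tnth (Tuple (introT eqP sz)) i]))//; last by move=> i; exact: measurable_rounded.
have := @prod_pmfE k (fun i => rounded_pmf (D i)) (Tuple (introT eqP sz)) => /= ->.
by rewrite -prodEFin; apply: eq_bigr => i _; rewrite rounded_pmfE.
Qed.

Variable q : Q -> X -> R.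

Lemma measurable_joint_error k (D : 'I_k -> {mset X}) :
  measurable_fun setT (@joint_error R X Q q M k D).
Proof.
rewrite /joint_error /max_error; elim: (index_enum Q) => [|f r IH].
  by under eq_fun do rewrite big_nil; exact: measurable_cst.
under eq_fun do rewrite big_cons.
apply: measurable_realfun.measurable_maxr => //.
apply: measurableT_comp; first exact: measurable_realfun.normr_measurable.
apply: measurable_realfun.measurable_funB => //.
apply: measurable_sum => j; apply: measurableT_comp => //.
exact: measurable_static_answer.
exact: measurable_tnth.
Qed.

(** Rounding down moves each of the [k] summands by at most [grid], which the slack absorbs. *)
Lemma rounded_error (k : nat) (beta slack : R) (alpha : nat -> nat -> R)
    (D : nat -> {mset X}) : (0 < k)%N -> k%:R * grid <= slack ->
  has_error q beta M alpha ->
  (mean (prod_pmf k (fun i => rounded_pmf (D i))) (fun zs =>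
     (alpha k (total_size (fun i : 'I_k => D i)) + slack <
      max_error (grid_sum k zs)
        (fun f => query q f (\big[@msetD X/@mset0 X]_(i < k) D i)))%R%:R%:E)
   <= beta%:E)%E.
Proof.
move=> k0 ks H; apply: le_trans (H k (fun i => D i) k0).
set a := alpha _ _; set tot := \big[_/_]_(i < k) D i.
set B : set (seq Z) := [set zs | a + slack < max_error (grid_sum k zs)
        (fun f => query q f tot)].
have [runsE mB] := runs_rounded k D B.
apply: (@le_trans _ _ (runs (fun i : 'I_k => static_law M (D i))
     [set y | B (map rounded y)])).
  rewrite runsE [leRHS]esum_mkcond; apply: le_esum => zs _.
  case: ifPn => [zB|]; last by rewrite notin_setE /B /= => /negP/negbTE ->; rewrite mule0.
  have : B zs by exact: set_mem.
  by rewrite /B /= => ->; rewrite mule1.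
apply: le_measure; rewrite ?inE//.
  rewrite (_ : [set _ | _] =
    @joint_error R X Q q M k (fun i => D i) @^-1` `]a, +oo[%classic); last first.
    by apply/seteqP; split => y /=; rewrite in_itv /= andbT.
  by rewrite -[X in measurable X]setTI; exact: measurable_joint_error.
move=> y; rewrite /B /= => lt_B; rewrite ltNge; apply/negP => le_a.
move: lt_B; rewrite ltNge => /negP; apply.
have slack0 : 0 <= slack by apply: le_trans ks; rewrite mulr_ge0// ltW.
have joint0 : 0 <= joint_error q (fun i : 'I_k => D i) y by exact: max_error_ge0.
apply: max_error_le => [|f]; first by lra.
apply: (@le_trans _ _ (k%:R * grid +
  `|\sum_(j < k) static_answer f (tnth y j) - query q f tot|)); last first.
  rewrite addrC lerD// (le_trans _ le_a)//.
  exact: (le_max_error (fun f => \sum_(j < k) static_answer f (tnth y j))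
    (fun f => query q f tot) f).
rewrite /grid_sum; set u := \sum_(l < k) _; set v := \sum_(j < k) _.
have : `|u - v| <= k%:R * grid.
  rewrite /u /v -sumrB (le_trans (ler_norm_sum _ _ _))//.
  rewrite mulr_natl -[k in X in _ <= X]card_ord -sumr_const ler_sum// => j _.
  rewrite (nth_map (tnth_default y j)) ?size_tuple// -tnth_nth ffunE.
  have := floor_itv (static_answer f (tnth y j) / grid).
  move: (static_answer f (tnth y j)) => r.
  rewrite ler_pdivlMr// ltr_pdivrMr// intrD => /andP[h1 h2].
  by rewrite ler_norml; apply/andP; split; lra.
by move=> huv; have := ler_normD (u - v) (v - query q f tot); rewrite addrA subrK; lra.
Qed.

End discretisation.

(** * The runs of the binary counter for given decisions *)

Section mechanism.
Local Open Scope mset_scope.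
Local Open Scope ring_scope.
Context {R : realType} {X : choiceType} {Z : countType}.
Variables (z0 : Z) (gain : nat -> nat) (pm : nat -> {mset X} -> Z -> R).
Hypothesis gain_gt0 : forall t, (0 < gain t)%N.
Hypothesis pmf_pm : forall e D, pmf (pm e D).

(* Items paired with the number of their segment; b holds the decisions taken
   before the newest item of s. *)
Fixpoint tagged (s : seq (option X)) (b : seq bool) : seq (nat * X) :=
  if s is a :: s' then
    (if a is Some x then [:: (count id b, x)] else [::]) ++ tagged s' (behead b)
  else [::].

(** [behead b] aligns the lists: the segment number of an item counts the closings strictly before
    its own time. *)
Definition level_items s b l : seq X :=
  [seq p.2 | p <- tagged s (behead b) & in_level gain b l p.1].

Definition level_data s b l : {mset X} := seq_mset (level_items s b l).

(* A level that is not refreshed repeats its previous output. *)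
Definition run_pmf s b (zs : seq Z) (l : nat) : Z -> R :=
  if refresh gain b l then pm (epoch gain b) (level_data s b l)
  else point_pmf (nth z0 zs l).

Fixpoint runs_law (s : seq (option X)) (b : seq bool) (zs : seq (seq Z)) : R :=
  match s, b, zs with
  | [::], [::], [::] => 1
  | a :: s', c :: b', z :: zs' => runs_law s' b' zs' *
      prod_pmf (levels gain (c :: b'))
        (run_pmf (a :: s') (c :: b') (head [::] zs')) z
  | _, _, _ => 0
  end.

Lemma pmf_run s b zs l : pmf (run_pmf s b zs l).
Proof. by rewrite /run_pmf; case: ifP => _; [exact: pmf_pm|exact: pmf_point]. Qed.

Lemma pmf_prod_run s b zs : pmf (prod_pmf (levels gain b) (run_pmf s b zs)).
Proof. by apply: pmf_prod => l; exact: pmf_run. Qed.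

Lemma runs_law_ge0 s b zs : 0 <= runs_law s b zs.
Proof.
elim: s b zs => [|a s IH] [|c b] [|z zs]//=.
by rewrite mulr_ge0// (pmf_prod_run (a :: s) (c :: b) _).1.
Qed.

Lemma runs_law_size s b zs : runs_law s b zs != 0 ->
  size zs = size s /\ size b = size s.
Proof.
elim: s b zs => [|a s IH] [|c b] [|z zs]//=; rewrite ?eqxx//.
by rewrite mulf_eq0 negb_or => /andP[/IH[-> ->]].
Qed.

Lemma runs_law_cons_sum a s c b (F : seq (seq Z) -> \bar R) :
  (forall zs, 0 <= F zs)%E ->
  mean (runs_law (a :: s) (c :: b)) F =
  mean (runs_law s b) (fun zs =>
    mean (prod_pmf (levels gain (c :: b))
      (run_pmf (a :: s) (c :: b) (head [::] zs))) (fun z => F (z :: zs))).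
Proof.
move=> F0; rewrite /mean esum_cons; last first.
  by move=> zs; rewrite mule_ge0// lee_fin runs_law_ge0.
rewrite mul0e add0e esum_exchange; last first.
  by move=> z zs; rewrite mule_ge0// lee_fin runs_law_ge0.
apply: eq_esum => zs _; rewrite -esumZl ?runs_law_ge0//; last first.
  by move=> z; rewrite mule_ge0// lee_fin (pmf_prod_run (a :: s) (c :: b) _).1.
by apply: eq_esum => z _; rewrite /= EFinM muleA.
Qed.

Lemma pmf_runs_law s b : size b = size s -> pmf (runs_law s b).
Proof.
move=> sz; split; first exact: runs_law_ge0.
elim: s b sz => [|a s IH] [|c b]//.
  rewrite (@esum_point _ _ [::])//; last by case.
  by move=> zs; rewrite lee_fin runs_law_ge0.
move=> [sz]; transitivity (mean (runs_law (a :: s) (c :: b)) (fun=> 1%:E)).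
  by rewrite /mean; apply: eq_esum => zs _; exact: (esym (mule1 _)).
rewrite runs_law_cons_sum//; transitivity (mean (runs_law s b) (fun=> 1%:E)).
  by apply: eq_mean => zs _; apply: mean_cst => //; exact: pmf_prod_run.
by rewrite -[RHS](IH b sz) /mean; apply: eq_esum => zs _; exact: mule1.
Qed.

Lemma tagged_le s b p : p \in tagged s b -> (p.1 <= count id b)%N.
Proof.
elim: s b => //= a s IH b; rewrite mem_cat => /orP[|/IH h].
  by case: a => // x; rewrite inE => /eqP ->.
by apply: leq_trans h _; case: b => //= c b; rewrite leq_addl.
Qed.

(** A new item carries the number [count id b], and an unmoved cut is at most that, so the item
    cannot enter the level. *)
Lemma level_data_stable a s c b l : ~~ refresh gain (c :: b) l ->
  level_data (a :: s) (c :: b) l = level_data s b l.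
Proof.
rewrite /refresh !negb_or => /and3P[_ /negPn/eqP h1 /negPn/eqP h2].
rewrite /level_data /level_items /in_level h1 h2 /=.
rewrite filter_cat map_cat; case: a => //= x.
have -> : (count id b < cut gain b l)%N = false by rewrite ltnNge cut_le.
by rewrite andbF.
Qed.

(** The outputs in use at one time were drawn at different times. Refreshes depend on the decisions
    only, and a level that is not refreshed has unchanged data, so jointly they are distributed like
    fresh independent runs on the current levels. This makes [has_error] applicable. *)
Lemma mean_runs_law s b (F : seq Z -> \bar R) : b != [::] -> size b = size s ->
  (forall z, 0 <= F z)%E ->
  mean (runs_law s b) (fun zs => F (head [::] zs)) =
  mean (prod_pmf (levels gain b) (fun l => pm (epoch gain b) (level_data s b l))) F.
Proof.
elim: s b F => [|a s IH] [|c b]// F _ [sz] F0.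
rewrite runs_law_cons_sum//; rewrite -[LHS]/(mean (runs_law s b) (fun zs =>
  mean (prod_pmf (levels gain (c :: b))
    (run_pmf (a :: s) (c :: b) (head [::] zs))) F)).
have pr zs i : pmf (run_pmf (a :: s) (c :: b) zs i) by exact: pmf_run.
have [ren|nr] := boolP (renew gain (c :: b)).
  have E zs : run_pmf (a :: s) (c :: b) zs =
      (fun l => pm (epoch gain (c :: b)) (level_data (a :: s) (c :: b) l)).
    by apply/funext => l; rewrite /run_pmf /refresh ren.
  under eq_mean do rewrite E.
  rewrite mean_cst//; first exact: pmf_runs_law.
  by apply: mean_ge0 => //; exact: pmf_prod.
have b0 : b != [::] by move: nr; rewrite /renew negb_or => /andP[].
have epochE : epoch gain (c :: b) = epoch gain b.
  by move: nr; rewrite /renew negb_or => /andP[_ /negPn/eqP].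
rewrite (IH b (fun z => mean (prod_pmf (levels gain (c :: b))
  (run_pmf (a :: s) (c :: b) z)) F))//; last first.
  by move=> z; apply: mean_ge0 => //; exact: pmf_prod_run.
have -> : levels gain (c :: b) = levels gain b by rewrite /levels epochE.
apply: etrans.
  exact: (@mean_prod_refresh _ _ (levels gain b) z0 (refresh gain (c :: b))
    (fun l => pm (epoch gain b) (level_data s b l))
    (fun l => pm (epoch gain (c :: b)) (level_data (a :: s) (c :: b) l)) F).
apply: (congr1 (fun p => mean p F)); apply/funext => zs. apply: eq_prod_pmf => l _.
by case: ifPn => // h; rewrite epochE (level_data_stable a s h).
Qed.

Section adjacent.
Variables (eps delta : R).
Hypothesis delta_ge0 : 0 <= delta.
Hypothesis pm_DP : forall e D D', neighbor D D' ->
  (hockey_stick (expR (eps * share e)) (pm e D) (pm e D')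
    <= (delta * share e)%:E)%E.

(* Two histories differing by one item of segment sg. *)
Definition level_adjacent (sg : nat) s s' b l : Prop :=
  if in_level gain b l sg
  then neighbor (level_data s b l) (level_data s' b l)
  else level_data s b l = level_data s' b l.

Fixpoint adjacent (sg : nat) (s s' : seq (option X)) (b : seq bool) : Prop :=
  match s, s', b with
  | _ :: t, _ :: t', _ :: b' =>
      (forall l, level_adjacent sg s s' b l) /\ adjacent sg t t' b'
  | [::], [::], [::] => True
  | _, _, _ => False
  end.

Lemma adjacent_sym sg s s' b : adjacent sg s s' b -> adjacent sg s' s b.
Proof.
elim: s s' b => [|a s IH] [|a' s'] [|c b] // [h /IH h']; split; last exact: h'.
move=> l; have := h l; rewrite /level_adjacent; case: (in_level _ _ _ _).
  by move=> [x [e|e]]; exists x; [right|left].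
by move=> ->.
Qed.

Lemma adjacent_refl sg s b : size b = size s -> (count id b <= sg)%N ->
  adjacent sg s s b.
Proof.
elim: s b => [|a s IH] [|c b] // [sz] le_sg; split; last first.
  by apply: IH sz _; apply: leq_trans le_sg; rewrite /= leq_addl.
move=> l; rewrite /level_adjacent.
case: (boolP (in_level _ _ _ _)) => // /in_level_count.
by rewrite ltnNge le_sg.
Qed.

(** Composition over time of products over levels. A charge arises only where a refreshed level
    contains [sg]; a repeated output is the same point mass on both sides. *)
Lemma runs_law_DP sg s s' b : adjacent sg s s' b ->
  (hockey_stick (expR (eps * cost gain sg b)) (runs_law s b) (runs_law s' b)
    <= (delta * cost gain sg b)%:E)%E.
Proof.
elim: s s' b => [|a s IH] [|a' s'] [|c b]//=.
  by move=> _; rewrite !mulr0 expR0 hockey_stick_self.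
move=> [h adj].
rewrite /hockey_stick esum_cons; last by move=> zs; rewrite lee_fin max0_ge0.
rewrite mulr0 subr0 maxxx add0e esum_exchange; last first.
  by move=> z zs; rewrite lee_fin max0_ge0.
rewrite !mulrDr expRD EFinD.
have szb : size b = size s /\ size b = size s'.
  by move: adj; clear; elim: s s' b => [|a s IH] [|a' s'] [|c b]//= [_ /IH[-> ->]].
have step0 l : 0 <= step_cost gain sg (c :: b) l :> R.
  by rewrite mulr_ge0// ltW// share_gt0.
apply: hockey_stick_comp.
- exact: expR_ge0.
- exact: expR_ge0.
- by rewrite lee_fin mulr_ge0// sumr_ge0.
- exact: runs_law_ge0.
- exact: runs_law_ge0.
- by move=> zs z; exact: (pmf_prod_run (a :: s) (c :: b) _).1.
- by move=> zs z; exact: (pmf_prod_run (a' :: s') (c :: b) _).1.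
- by rewrite (pmf_runs_law szb.1).2.
- by move=> zs; rewrite (pmf_prod_run (a :: s) (c :: b) _).2.
- exact: IH.
move=> zs; apply: hockey_stick_prod.
- exact: delta_ge0.
- exact: step0.
- by move=> i; exact: pmf_run.
- by move=> i; exact: pmf_run.
move=> l; rewrite /step_cost /run_pmf; case: (refresh _ _ _); last first.
  by rewrite mul0r !mulr0 expR0 hockey_stick_self.
have := h l; rewrite /level_adjacent; case: (in_level _ _ _ _); last first.
  by move=> ->; rewrite mul0r !mulr0 expR0 hockey_stick_self.
by rewrite mul1r; exact: pm_DP.
Qed.

End adjacent.

Lemma tagged_insert s1 s2 x b :
  perm_eq (tagged (s1 ++ Some x :: s2) b)
    ((count id (drop (size s1) b), x) :: tagged (s1 ++ None :: s2) b).
Proof.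
elim: s1 b => [|a s1 IH] b /=; first by rewrite drop0.
have -> : drop (size s1).+1 b = drop (size s1) (behead b).
  by case: b => //=; rewrite drop_nil.
rewrite -cat_cons -[X in perm_eq _ X]cat1s catA.
rewrite (perm_trans _ (perm_cat (permEl (perm_catC _ _)) (perm_refl _)))//.
by rewrite -catA perm_cat2l.
Qed.

(** The dropped list holds the decisions before the extra item arrived, so its count is the segment
    number of that item. *)
Lemma adjacent_insert s1 s2 x b : size b = (size s1 + size s2)%N.+1 ->
  adjacent (count id (drop (size s1).+1 b)) (s1 ++ None :: s2) (s1 ++ Some x :: s2) b.
Proof.
have level s b' l c : level_adjacent (count id (drop (size s) b'))
    (s ++ None :: s2) (s ++ Some x :: s2) (c :: b') l.
  rewrite /level_adjacent /level_data /level_items [behead _]/=.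
  set sg := count _ _; set P := fun p : nat * X => in_level gain (c :: b') l p.1.
  have : perm_eq [seq p.2 | p <- tagged (s ++ Some x :: s2) b' & P p]
      [seq p.2 | p <- (sg, x) :: tagged (s ++ None :: s2) b' & P p].
    by apply/perm_map/perm_filter; exact: tagged_insert.
  move=> /eq_seq_msetP ->.
  have -> : [seq p.2 | p <- (sg, x) :: tagged (s ++ None :: s2) b' & P p] =
      (if P (sg, x) then [:: x] else [::]) ++
      [seq p.2 | p <- tagged (s ++ None :: s2) b' & P p].
    by rewrite [seq.filter _ _]/=; case: (P _).
  rewrite -[in_level _ _ _ sg]/(P (sg, x)); case: (P _); last by rewrite cat0s.
  by exists x; left; rewrite cat1s mset_cons.
elim: s1 b => [|a s1 IH] [|c b] // [sz]; split.
- by move=> l; exact: (level [::]).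
- by rewrite /= drop0; apply: adjacent_refl.
- by move=> l; case: b sz (level (a :: s1) b l c).
- exact: IH.
Qed.

End mechanism.

(** * The joint law of decisions and runs *)

Section transcripts.
Context {R : realType}.
Local Open Scope ereal_scope.

Lemma esum_unzip (A B : choiceType) (f : seq A -> seq B -> \bar R) :
  (forall b zs, 0 <= f b zs) -> (forall b zs, size b != size zs -> f b zs = 0) ->
  \esum_(ys in [set: seq (A * B)]) f (unzip1 ys) (unzip2 ys) =
  \esum_(b in setT) \esum_(zs in setT) f b zs.
Proof.
move=> f0 fsz; rewrite -(@esum_pair _ _ _ (fun p => f p.1 p.2))//.
rewrite [RHS](esumID [set p : seq A * seq B | size p.1 = size p.2])//.
rewrite [X in _ = _ + X]esum1 ?adde0; last first.
  by move=> p [_ /eqP]; exact: fsz.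
rewrite setTI (reindex_esum [set: seq (A * B)] _
  (fun ys => (unzip1 ys, unzip2 ys)))//; split=> /=.
- by move=> ys _; rewrite /= !size_map.
- by move=> u v _ _ [uv1 uv2]; rewrite -(zip_unzip u) -(zip_unzip v) uv1 uv2.
- move=> [b zs] /= sz; exists (zip b zs) => //.
  by rewrite unzip1_zip ?unzip2_zip// sz.
Qed.

Lemma hockey_stick_event (T : choiceType) (c : R) (r : \bar R) (p p' : T -> R) A :
  (0 <= c)%R -> (forall x, 0 <= p x)%R -> (forall x, 0 <= p' x)%R ->
  hockey_stick c p p' <= r ->
  \esum_(x in A) (p x)%:E <= c%:E * (\esum_(x in A) (p' x)%:E) + r.
Proof.
move=> c0 p0 p'0 hr; rewrite -esumZl// addeC.
apply: (@le_trans _ _ ((\esum_(x in A) (Num.max 0 (p x - c * p' x))%:E) +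
   \esum_(x in A) (c%:E * (p' x)%:E))).
  rewrite -esumD; last 2 first.
  - by move=> x _; rewrite lee_fin max0_ge0.
  - by move=> x _; rewrite -EFinM lee_fin mulr_ge0.
  apply: le_esum => x _; rewrite -EFinM -EFinD lee_fin -lerBlDr.
  by rewrite le_max lexx orbT.
rewrite leeD2r//; apply: le_trans hr; apply: le_esum_subset => //.
by move=> x; rewrite lee_fin max0_ge0.
Qed.

Context {X : choiceType} {Z : countType}.
Variables (z0 : Z) (gain : nat -> nat) (eta : R) (thr : nat -> R)
  (pm : nat -> {mset X}%mset -> Z -> R).
Hypothesis gain_gt0 : forall t, (0 < gain t)%N.
Hypothesis pmf_pm : forall e D, pmf (pm e D).

Definition transcript_law (s : seq (option X)) (ys : seq (bool * seq Z)) : R :=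
  (bits_law eta thr s (unzip1 ys) * runs_law z0 gain pm s (unzip1 ys) (unzip2 ys))%R.

Lemma transcript_law_ge0 s ys : (0 <= transcript_law s ys)%R.
Proof. by rewrite mulr_ge0 ?bits_law_ge0 ?runs_law_ge0. Qed.

Lemma transcript_law_size s ys : size ys != size s -> transcript_law s ys = 0%R.
Proof.
move=> /eqP sz; apply/eqP; apply: contraPT sz => nz; apply.
by move: nz; rewrite mulf_eq0 negb_or => /andP[/bits_law_size <- _]; rewrite size_map.
Qed.

Lemma mean_transcript s (F : seq bool -> seq (seq Z) -> \bar R) :
  (forall b zs, 0 <= F b zs) ->
  mean (transcript_law s) (fun ys => F (unzip1 ys) (unzip2 ys)) =
  mean (bits_law eta thr s) (fun b => mean (runs_law z0 gain pm s b) (F b)).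
Proof.
move=> F0; rewrite /mean /transcript_law.
rewrite (esum_unzip (f := fun b zs =>
  (bits_law eta thr s b * runs_law z0 gain pm s b zs)%R%:E * F b zs)).
- apply: eq_esum => b _; rewrite -esumZl ?bits_law_ge0//; last first.
    by move=> zs; rewrite mule_ge0 ?lee_fin ?runs_law_ge0.
  by apply: eq_esum => zs _; rewrite EFinM muleA.
- by move=> b zs; rewrite mule_ge0// lee_fin mulr_ge0 ?bits_law_ge0 ?runs_law_ge0.
- move=> b zs /eqP sz; have [->|/runs_law_size[h1 h2]] := eqVneq (runs_law z0 gain pm s b zs) 0%R.
    by rewrite mulr0 mul0e.
  by exfalso; apply: sz; rewrite h1 h2.
Qed.

Lemma transcript_law_cons a s ys : size ys = size s ->
  \esum_(y in setT) (transcript_law (a :: s) (y :: ys))%:E = (transcript_law s ys)%:E.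
Proof.
move=> sz; rewrite esum_pair; last by move=> y; rewrite lee_fin transcript_law_ge0.
rewrite esum_bool; last first.
  by move=> c; apply: esum_ge0 => z _; rewrite lee_fin transcript_law_ge0.
have E c : \esum_(z in setT) (transcript_law (a :: s) ((c, z) :: ys))%:E =
    (transcript_law s ys * bit_prob eta thr a s (unzip1 ys) c)%:E.
  rewrite -[RHS]mule1 -(pmf_prod_run z0 gain pmf_pm (a :: s) (c :: unzip1 ys)
    (head [::] (unzip2 ys))).2 -esumZl; last 2 first.
  - by rewrite mulr_ge0 ?transcript_law_ge0 ?bit_prob_ge0.
  - by move=> z; rewrite lee_fin (pmf_prod_run z0 gain pmf_pm (a :: s) (c :: unzip1 ys) _).1.
  apply: eq_esum => z _; rewrite -EFinM /transcript_law; congr EFin.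
  by rewrite [runs_law _ _ _ (_ :: _) _ _]/=; rewrite /=; ring.
by rewrite !E -EFinD -mulrDr bit_prob_sum mulr1.
Qed.

(** Write a for the law of the decisions and b for that of the runs. As a <= exp(eta) a', one has a
    b - exp(2 eta) a' b' <= a (b - exp(eta) b'), so the decisions leave delta untouched. The segment
    depends on the decisions, but the cost bound 1/2 is uniform and survives averaging. *)
Lemma transcript_law_DP (eps delta : R) s s' (sg : seq bool -> nat) :
  (0 <= eps)%R -> (0 <= delta)%R -> (eta = eps / 2)%R ->
  (forall e D D', neighbor D D' ->
    hockey_stick (expR (eps * share e)) (pm e D) (pm e D') <= (delta * share e)%:E) ->
  (forall b, (bits_law eta thr s b <= expR eta * bits_law eta thr s' b)%R) ->
  (forall b, size b = size s -> adjacent gain (sg b) s s' b) ->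
  hockey_stick (expR eps) (transcript_law s) (transcript_law s') <= delta%:E.
Proof.
move=> eps0 delta0 etaE pm_DP le_bits adj.
pose K b := \esum_(zs in setT)
  (Num.max 0 (runs_law z0 gain pm s b zs - expR eta * runs_law z0 gain pm s' b zs))%:E.
apply: (@le_trans _ _ (mean (bits_law eta thr s) K)).
  apply: (@le_trans _ _ (\esum_(ys in setT) ((bits_law eta thr s (unzip1 ys))%:E *
     (Num.max 0 (runs_law z0 gain pm s (unzip1 ys) (unzip2 ys) -
       expR eta * runs_law z0 gain pm s' (unzip1 ys) (unzip2 ys)))%:E))).
    apply: le_esum => ys _; rewrite -EFinM lee_fin /transcript_law.
    move: (unzip1 ys) (unzip2 ys) => b zs.
    rewrite ge_max mulr_ge0 ?bits_law_ge0 ?max0_ge0//=.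
    apply: (@le_trans _ _ (bits_law eta thr s b * (runs_law z0 gain pm s b zs -
      expR eta * runs_law z0 gain pm s' b zs))%R); last first.
      by rewrite ler_wpM2l ?bits_law_ge0// le_max lexx orbT.
    rewrite mulrBr lerB// [X in (_ <= X)%R](_ : _ =
      (expR eta * (expR eta * bits_law eta thr s' b)) * runs_law z0 gain pm s' b zs)%R.
      rewrite mulrCA mulrA ler_wpM2r ?runs_law_ge0//.
      by rewrite ler_wpM2l ?expR_ge0.
    have -> : expR eps = (expR eta * expR eta)%R by rewrite -expRD etaE -splitr.
    ring.
  rewrite (esum_unzip (f := fun b zs => (bits_law eta thr s b)%:E *
     (Num.max 0 (runs_law z0 gain pm s b zs -
       expR eta * runs_law z0 gain pm s' b zs))%:E)).
  - apply: le_esum => b _; rewrite esumZl ?bits_law_ge0//.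
    by move=> zs; rewrite lee_fin max0_ge0.
  - by move=> b zs; rewrite mule_ge0// lee_fin ?bits_law_ge0 ?max0_ge0.
  - move=> b zs nsz.
    have r0 t : runs_law z0 gain pm t b zs = 0%R.
      apply/eqP; apply: contraNT nsz => /runs_law_size[-> ->].
      by rewrite eqxx.
    by rewrite !r0 mulr0 subr0 maxxx mule0.
apply: (@le_trans _ _ (mean (bits_law eta thr s) (fun=> delta%:E))); last first.
  by rewrite mean_cst ?lee_fin//; exact: pmf_bits.
apply: le_mean; first exact: pmf_bits.
move=> b /bits_law_size sz.
have h := runs_law_DP z0 pmf_pm delta0 pm_DP (adj b sz).
have c_half := @cost_le_half gain gain_gt0 R (sg b) b.
have c0 := @cost_ge0 gain R (sg b) b.
apply: (le_trans _ (le_trans h _)); last first.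
  by rewrite lee_fin ler_piMr//; lra.
apply: le_esum => zs _; rewrite lee_fin ge_max max0_ge0/= le_max; apply/orP; right.
by rewrite lerB// ler_wpM2r ?runs_law_ge0// ler_expR etaE ler_wpM2l//; lra.
Qed.

End transcripts.

(** * Splitting query values into levels and the open segment *)

Section queries.
Local Open Scope mset_scope.
Local Open Scope ring_scope.
Context {R : realType} {X : choiceType} {Q : finType}.
Variable q : Q -> X -> R.

Lemma query_seq_mset f (s : seq X) : query q f (seq_mset s) = \sum_(x <- s) q f x.
Proof. exact/perm_big/perm_eq_seq_mset. Qed.

Lemma query_msetD f (A B : {mset X}) : query q f (A `+` B) = query q f A + query q f B.
Proof.
rewrite -[A in LHS]seq_mset_id -[B in LHS]seq_mset_id /query.
have -> : seq_mset A `+` seq_mset B = seq_mset (A ++ B).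
  by apply/msetP => a; rewrite msetE2 !mset_seqE count_cat.
by rewrite -big_cat; exact/perm_big/perm_eq_seq_mset.
Qed.

Lemma query_mset0 f : query q f mset0 = 0.
Proof. exact: big_mset0. Qed.

Variable gain : nat -> nat.

Lemma sum_levels (V : nmodType) (h : X -> V) s b :
  \sum_(l < levels gain b) \sum_(x <- level_items gain s b l) h x =
  \sum_(p <- tagged s (behead b) | (p.1 < count id b)%N) h p.2.
Proof.
under eq_bigr do rewrite /level_items big_map big_filter big_mkcond.
rewrite exchange_big [RHS]big_mkcond; apply: eq_bigr => p _ /=.
have := sum_in_level gain b p.1.
have -> : \sum_(l < levels gain b) (if in_level gain b l p.1 then h p.2 else 0) =
    h p.2 *+ (\sum_(l < levels gain b) in_level gain b l p.1)%N.
  by rewrite -sumrMnr; apply: eq_bigr => l _; case: in_level.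
by move=> ->; case: ltnP.
Qed.

Lemma sum_tagged (V : nmodType) (h : X -> V) (s : seq (option X)) b :
  \sum_(p <- tagged s b) h p.2 = \sum_(x <- pmap id s) h x.
Proof.
elim: s b => [|a s IH] b; first by rewrite !big_nil.
by rewrite /= big_cat IH; case: a => [x|] /=; rewrite ?big_cons ?big_nil ?add0r ?addr0.
Qed.

Lemma count_tagged (s : seq (option X)) b : size b = size s ->
  count (fun p => p.1 < count id b)%N (tagged s (behead b)) = covered s b.
Proof.
elim: s b => [|a s IH] [|c b]//= [sz].
have tl p : p \in tagged s (behead b) -> (p.1 <= count id b)%N.
  by move=> /tagged_le h; apply: leq_trans h _; case: (b) => //= c' b'; rewrite leq_addl.
rewrite count_cat; case: c => /=; last first.
  rewrite add0n IH//; case: a => //= x.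
  by rewrite ltnn.
have -> : count (fun p => p.1 < 1 + count id b)%N (tagged s (behead b)) =
    size (tagged s (behead b)).
  by apply/eqP; rewrite -all_count; apply/allP => p /tl; rewrite add1n ltnS.
have -> : size (tagged s (behead b)) = (covered s b + pend s b)%N.
  rewrite covered_pend//; move: (behead b); elim: (s) => //= a' s' IH' b'.
  by rewrite size_cat IH'; case: a'.
by case: a => [x|] /=; rewrite ?add1n ?ltnSn; lia.
Qed.

Lemma sum_open_le (h : X -> R) s b : size b = size s ->
  (forall x, 0 <= h x <= 1) ->
  0 <= \sum_(x <- pmap id s) h x -
    \sum_(p <- tagged s (behead b) | (p.1 < count id b)%N) h p.2 <= (pend s b)%:R.
Proof.
move=> sz h01; rewrite -(sum_tagged h s (behead b)).
rewrite [X in X - _](bigID (fun p => (p.1 < count id b)%N)) /= addrAC subrr add0r.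
apply/andP; split; first by apply: sumr_ge0 => p _; case/andP: (h01 p.2).
apply: (@le_trans _ _ (\sum_(p <- tagged s (behead b) | ~~ (p.1 < count id b)%N) 1)).
  by apply: ler_sum => p _; case/andP: (h01 p.2).
have -> : \sum_(p <- tagged s (behead b) | ~~ (p.1 < count id b)%N) 1 =
    (count (predC (fun p => p.1 < count id b)%N) (tagged s (behead b)))%:R :> R.
  by rewrite -[count (predC _) _]sum1_count natr_sum.
rewrite ler_nat.
have := count_predC (fun p => p.1 < count id b)%N (tagged s (behead b)).
rewrite count_tagged// => e; rewrite -(leq_add2l (covered s b)) e covered_pend//.
move: (behead b); elim: (s) => //= a' s' IH' b'.
by rewrite size_cat; case: a' => [x|] /=; rewrite ?add0n ?add1n ?ltnS IH'.
Qed.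

End queries.

(** * The threshold T_t and comparison constants *)

Section threshold.
Context {R : realType}.
Variables (eps beta : R).
Hypothesis eps_gt0 : 0 < eps.
Hypothesis beta01 : 0 < beta < 1.

(** For eta = eps / 2 this makes exp(- eta T / 2) equal to beta / (2 (n + 2)^3). One factor n + 2
    pays for the total weight, the other two for the telescoping term 1 / ((n + 1) (n + 2)). *)
Definition threshold (n : nat) : R := 4 / eps * ln (2 * n.+2%:R ^+ 3 / beta).

Let arg_gt1 (n : nat) : 1 < 2 * n.+2%:R ^+ 3 / beta.
Proof.
have /andP[b0 b1] := beta01; rewrite ltr_pdivlMr// mul1r (lt_le_trans b1)//.
have : 1 <= n.+2%:R ^+ 3 :> R by rewrite exprn_ege1// ler1n.
lra.
Qed.

Lemma threshold_gt0 n : 0 < threshold n.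
Proof. by rewrite mulr_gt0 ?divr_gt0 ?ln_gt0. Qed.

Lemma threshold_mono n : threshold n <= threshold n.+1.
Proof.
have /andP[b0 b1] := beta01.
rewrite /threshold ler_wpM2l ?divr_ge0 ?(ltW eps_gt0)// ler_ln ?posrE ?(lt_trans ltr01)//.
rewrite ler_pM2r ?invr_gt0// ler_pM2l// lerXn2r ?nnegrE ?ler0n//.
by rewrite ler_nat.
Qed.

Lemma threshold_tail n : n.+2%:R * expR (- (eps / 2 * threshold n / 2)) <=
  beta / 2 * (n.+1%:R^-1 - n.+2%:R^-1).
Proof.
have /andP[b0 b1] := beta01.
have -> : eps / 2 * threshold n / 2 = ln (2 * n.+2%:R ^+ 3 / beta).
  by rewrite /threshold; field; rewrite gt_eqF.
rewrite expRN lnK ?posrE ?(lt_trans ltr01)//.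
have n1 : n.+1%:R != 0 :> R by rewrite pnatr_eq0.
have n2 : n.+2%:R != 0 :> R by rewrite pnatr_eq0.
have -> : n.+2%:R * (2 * n.+2%:R ^+ 3 / beta)^-1 = beta / 2 * (n.+2%:R^-1 * n.+2%:R^-1).
  by move: n.+2%:R n2 => N n2; field; rewrite n2 gt_eqF.
rewrite ler_pM2l ?divr_gt0//.
have -> : n.+1%:R^-1 - n.+2%:R^-1 = n.+1%:R^-1 * n.+2%:R^-1 :> R.
  rewrite -(natr1 n.+1) in n2 *; move: n.+1%:R n1 n2 => N n1 n2.
  by field; rewrite n1 n2.
by rewrite ler_pM2r ?invr_gt0// lef_pV2 ?posrE// ler_nat.
Qed.

Lemma threshold_bound t : (0 < t)%N ->
  threshold t <= 36 * (eps^-1 * Num.max 1 (ln (t%:R / beta))).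
Proof.
move=> t0; have /andP[b0 b1] := beta01.
have t1 : 1 <= t%:R :> R by rewrite ler1n.
have tb0 : 0 < t%:R / beta by rewrite divr_gt0// (lt_le_trans ltr01).
have ln54 : ln (54 : R) <= 6.
  rewrite -[leRHS]expRK ler_ln ?posrE ?expR_gt0//.
  rewrite -[X in expR X]mulr1 expRM_natl.
  have e2 : 2 <= expR 1 :> R by have := @expR_ge1Dx R 1; lra.
  apply: (@le_trans _ _ (2 ^+ 6)); first by rewrite -natrX ler_nat.
  by rewrite lerXn2r ?nnegrE ?expR_ge0.
rewrite /threshold; set m := Num.max _ _.
have m1 : 1 <= m by rewrite le_max lexx.
have mln : ln (t%:R / beta) <= m by rewrite le_max lexx orbT.
(* From [t + 2 <= 3 t] and [beta < 1], the argument is at most 54 (t / beta)^3, with logarithm at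
   most 6 + 3 m <= 9 m. *)
have : ln (2 * t.+2%:R ^+ 3 / beta) <= 9 * m.
  apply: (@le_trans _ _ (ln (54 * (t%:R / beta) ^+ 3))).
    rewrite ler_ln ?posrE ?(lt_trans ltr01 (arg_gt1 t))//; last first.
      by rewrite mulr_gt0// exprn_gt0.
    have h1 : t.+2%:R ^+ 3 <= (3 * t%:R) ^+ 3 :> R.
      by rewrite lerXn2r ?nnegrE ?mulr_ge0 ?ler0n// -natrM ler_nat; lia.
    have h2 : beta^-1 <= beta^-1 ^+ 3.
      by rewrite -{1}[beta^-1]expr1 ler_weXn2l// invf_ge1 ?ltW.
    rewrite exprMn in h1.
    have c27 : 3 ^+ 3 = 27 :> R by ring.
    rewrite c27 in h1.
    apply: (@le_trans _ _ (54 * t%:R ^+ 3 * beta^-1)).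
      by rewrite ler_pM2r ?invr_gt0//; lra.
    by rewrite -[X in X <= _]mulrA ler_wpM2l// exprMn ler_wpM2l// exprn_ge0.
  rewrite lnM ?posrE ?exprn_gt0// lnXn// -[_ *+ 3]mulr_natl.
  by lra.
move=> /(ler_wpM2l (ltW (divr_gt0 (ltr0Sn R 3) eps_gt0))) /le_trans; apply.
by rewrite [X in _ <= X](_ : _ = 4 / eps * (9 * m))//; ring.
Qed.

End threshold.

(** As 11 <= 2 ^ 4, the logarithm grows by at most 4, which is at most [4 * clog m]. *)
Lemma clog_mul16 m n : (0 < m)%N -> (m <= n <= 11 * m)%N ->
  (clog m <= clog n <= 5 * clog m)%N.
Proof.
move=> m0 /andP[mn nm]; rewrite leq_clog//=.
have h : (up_log 2 n <= up_log 2 m + 4)%N.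
  apply: (@leq_trans (up_log 2 (2 ^ (up_log 2 m + 4)))).
    apply: leq_up_log; apply: (leq_trans nm); rewrite expnD mulnC.
    by rewrite leq_mul// up_logP.
  by rewrite up_expnK.
by rewrite /clog; lia.
Qed.

Lemma epoch_bounds m : (2 ^ up_log 2 (clog m) < 2 * clog m)%N /\
  (clog m <= 2 ^ up_log 2 (clog m))%N.
Proof.
split; last exact: up_logP.
have [le1|gt1] := leqP (clog m) 1.
  have -> : clog m = 1%N by have := clog_gt0 m; lia.
  by [].
have /andP[h _] := up_log_bounds (ltnSn 1) gt1.
have : (0 < up_log 2 (clog m))%N by rewrite up_log_gt0.
by case: (up_log _ _) h => // k; rewrite expnS /=; lia.
Qed.


(** The share is 1 / (8 * 2 ^ e), so [2 ^ e <= 2 * L] gives 1 / L <= 16 [share e]. This is the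
    origin of 16. *)
Lemma within_share (R : realType) (e L : nat) (x : R) : (0 < L)%N ->
  (2 ^ e <= 2 * L)%N -> (L <= 5 * 2 ^ e)%N -> 0 <= x ->
  Defs.within 16 (x / L%:R) (x * share e).
Proof.
move=> L0 eL Le x0.
have [] : (L%:R^-1 <= 16 * share e :> R) /\ (share e <= 16 * L%:R^-1 :> R); last first.
  by move=> h1 h2; split; rewrite mulrCA ler_wpM2l.
have p0 : 0 < 2 ^+ e :> R by rewrite exprn_gt0.
have l0 : 0 < L%:R :> R by rewrite ltr0n.
move: eL Le; rewrite -!(ler_nat R) !natrM natrX.
have -> : share e = (8 * 2 ^+ e)^-1 :> R.
  by rewrite /share exprD mulrC (_ : 2 ^+ 3 = 8 :> R)//; ring.
move: (2 ^+ e) L%:R p0 l0 => p l p0 l0 pl lp; split.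
  have -> : 16 * (8 * p)^-1 = (p / 2)^-1 by field; rewrite gt_eqF.
  rewrite lef_pV2 ?posrE//; first by rewrite ler_pdivrMr//; lra.
  by rewrite divr_gt0.
have -> : 16 * l^-1 = (l / 16)^-1 by field; rewrite gt_eqF.
rewrite lef_pV2 ?posrE; first by rewrite ler_pdivrMr//; lra.
  by rewrite mulr_gt0.
by rewrite divr_gt0.
Qed.

(** A negative bound would be exceeded by every outcome, against [beta < 1]. *)
Lemma error_fun_ge0 (R : realType) (X : choiceType) (Q : finType)
    (q : Q -> X -> R) (beta : R) (M : static_mechanism R X Q)
    (alpha : nat -> nat -> R) (k : nat) (D : 'I_k -> {mset X}%mset) :
  beta < 1 -> has_error q beta M alpha -> (0 < k)%N -> 0 <= alpha k (total_size D).
Proof.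
move=> b1 H k0; rewrite leNgt; apply/negP => alt0.
have := H k D k0; rewrite (_ : [set _ | _] = setT); last first.
  by apply/seteqP; split => // y _ /=; apply: lt_le_trans alt0 _; exact: max_error_ge0.
by rewrite probability_setT lee_fin leNgt b1.
Qed.

Lemma measurable_tuple_last (R : realType) (t : nat) (g : nat -> R) :
  measurable_fun setT (fun y : t.-tuple nat => g (last 0%N y)).
Proof.
case: t => [|t].
  rewrite (_ : (fun y => _) = (fun=> g 0%N)); first exact: measurable_cst.
  by apply/funext => y; rewrite tuple0.
rewrite (_ : (fun y => _) = g \o (fun y => tnth y ord_max)).
  by apply: measurableT_comp => //; exact: measurable_tnth.
by apply/funext => y; rewrite /= (last_nth 0%N) size_tuple (tnth_nth 0%N).
Qed.

(** * The mechanism and its privacy *)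

Section dynamic_mechanism.
Context {R : realType} {X : choiceType} {Q : finType}.
Variables (q : Q -> X -> R) (pure : bool)
  (M : R -> R -> R -> static_mechanism R X Q)
  (alpha : nat -> R -> R -> R -> nat -> R) (K : R -> R).
Hypothesis q01 : linear_queries q.
Hypothesis static_M : forall eps delta beta : R, admissible pure eps delta beta ->
  static_DP eps delta (M eps delta beta) /\
  has_error q beta (M eps delta beta) (fun k n => alpha k eps delta beta n).
Hypothesis alpha_absorbs : absorbs_constants pure K alpha.
Variables eps delta beta : R.
Hypothesis adm : admissible pure eps delta beta.

Notation Z := {ffun Q -> int}.

Let eps_gt0 : 0 < eps. Proof. by case: adm. Qed.

Let delta_ge0 : 0 <= delta.
Proof. by case: adm => _ + _; case: pure => [->//|/andP[/ltW]]. Qed.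

Let beta01 : 0 < beta < 1. Proof. by case: adm. Qed.

Let beta_gt0 : 0 < beta. Proof. by case/andP: beta01. Qed.

Definition thr := threshold eps beta.

Let thr_gt0 n : 0 < thr n.
Proof. exact: threshold_gt0. Qed.

Definition gain := min_gain thr.

Let gain_gt0 t : (0 < gain t)%N.
Proof. exact: min_gain_gt0. Qed.

(* An epoch uses (2 ^ e).+1 runs, whose rounding errors add up to 1 / eps. *)
Definition epoch_grid (e : nat) : R := (eps * (2 ^ e).+1%:R)^-1.

Let epoch_grid_gt0 e : 0 < epoch_grid e.
Proof. by rewrite invr_gt0 mulr_gt0. Qed.

(** The other half of [beta] is reserved for bad decisions. *)
Definition epoch_mechanism (e : nat) : static_mechanism R X Q :=
  M (eps * share e) (delta * share e) (beta / 2).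

Lemma admissible_epoch e : admissible pure (eps * share e) (delta * share e) (beta / 2).
Proof.
have sh0 : 0 < share e :> R := share_gt0 e.
have sh1 : share e <= 1 :> R.
  by rewrite /share invf_le1 ?exprn_gt0// exprn_ege1// ler1n.
split; first by rewrite mulr_gt0.
  case: adm => _ + _; case: pure => [->|/andP[d0 d1]]; first by rewrite mul0r.
  by rewrite mulr_gt0//= (le_lt_trans _ d1)// ler_piMr// ltW.
by have /andP[b0 b1] := beta01; rewrite divr_gt0//=; lra.
Qed.

Definition epoch_pmf (e : nat) (D : {mset X}%mset) : Z -> R :=
  @rounded_pmf R X Q (epoch_mechanism e) (epoch_grid e) D.

Let pmf_epoch e D : pmf (epoch_pmf e D).
Proof. exact: pmf_rounded. Qed.

Let epoch_pmf_DP e D D' : neighbor D D' ->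
  (hockey_stick (expR (eps * share e)) (epoch_pmf e D) (epoch_pmf e D')
    <= (delta * share e)%:E)%E.
Proof.
by apply: rounded_pmf_DP => //; exact: (static_M (admissible_epoch e)).1.
Qed.

Let zero_output : Z := [ffun=> 0].

Definition law := transcript_law zero_output gain (eps / 2) thr epoch_pmf.

Notation Y := (bool * seq Z)%type.

Definition transcript (s : seq (option X)) (w : R) : seq Y :=
  decode ((false, [::]) : Y) law s w.

Let law_nil : law [::] [::] = 1.
Proof. by rewrite /law /transcript_law /= mulr1. Qed.

Let law_cons (a : option X) s ys : size ys = size s ->
  (\esum_(y in setT) (law (a :: s) (y :: ys))%:E = (law s ys)%:E)%E.
Proof. exact: transcript_law_cons. Qed.

Let law_ge0 s ys : 0 <= law s ys.
Proof. exact: transcript_law_ge0. Qed.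

Let law_size s ys : size ys != size s -> law s ys = 0.
Proof. exact: transcript_law_size. Qed.

Lemma measurable_transcript_in s (A : set (seq Y)) :
  measurable [set w : measurableTypeR R | A (transcript s w)].
Proof.
apply: measurable_countable_preimage.
exact: (measurable_decode _ law_ge0 law_nil law_cons).
Qed.

Lemma transcript_law_in s (A : set (seq Y)) :
  unit_uniform [set w | A (transcript s w)] = (\esum_(ys in A) (law s ys)%:E)%E.
Proof. exact: (decode_law_in _ law_ge0 law_nil law_cons law_size). Qed.

(** Prefixes list the oldest entry first, transcripts the newest, hence [rev]. Each release contains
    the whole transcript so far, so the last one suffices for answering. *)
Definition release_code (s : seq (option X)) (w : R) : nat :=
  choice.pickle (transcript (rev s) w).

Lemma measurable_release_code s :
  measurable_fun setT (release_code s : measurableTypeR R -> nat).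
Proof.
move=> _ B _; rewrite setTI.
exact: (measurable_transcript_in (rev s) (fun ys => B (choice.pickle ys))).
Qed.

Definition code_transcript (n : nat) : seq Y := odflt [::] (choice.unpickle n).

(* While the certified number of covered items is below the threshold, the
   whole dataset is smaller than the allowed error and 0 is a safe answer. *)
Definition state_estimate (b : seq bool) (z : seq Z) (f : Q) : R :=
  if thr (size b) <= (gains gain b)%:R
  then grid_sum (epoch_grid (epoch gain b)) (levels gain b) z f else 0.

Definition estimate (ys : seq Y) : Q -> R :=
  state_estimate (unzip1 ys) (head [::] (unzip2 ys)).

Definition segment_mechanism : dynamic_mechanism R X Q :=
  Build_dynamic_mechanism unit_uniform measurable_release_code
    (fun f t => measurable_tuple_last (fun n => estimate (code_transcript n) f)).

Lemma prefix_DP s1 s2 x (A : set (seq Y)) :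
  (unit_uniform [set w | A (transcript (s1 ++ None :: s2) w)] <=
   (expR eps)%:E * unit_uniform [set w | A (transcript (s1 ++ Some x :: s2) w)] + delta%:E)%E /\
  (unit_uniform [set w | A (transcript (s1 ++ Some x :: s2) w)] <=
   (expR eps)%:E * unit_uniform [set w | A (transcript (s1 ++ None :: s2) w)] + delta%:E)%E.
Proof.
have eta0 : 0 <= eps / 2 by rewrite divr_ge0 ?ltW.
have szE b : size b = size (s1 ++ None :: s2) -> size b = (size s1 + size s2)%N.+1.
  by move=> ->; rewrite size_cat /= addnS.
rewrite !transcript_law_in; split; apply: hockey_stick_event => //;
  rewrite ?expR_ge0//;
  apply: (transcript_law_DP zero_output gain_gt0 pmf_epoch
     (sg := fun b => count id (drop (size s1).+1 b)) (ltW eps_gt0) delta_ge0 erefl epoch_pmf_DP).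
- by move=> b; exact: (bits_privacy thr eta0 s2 x s1 b).1.
- by move=> b /szE sz; exact: adjacent_insert.
- by move=> b; exact: (bits_privacy thr eta0 s2 x s1 b).2.
- move=> b sz; apply: adjacent_sym; apply: adjacent_insert; apply: szE.
  by rewrite sz !size_cat.
Qed.

Lemma rev_mkseq_split (x : stream X) i n : (i < n)%N ->
  exists s1 s2, forall x' : stream X, (forall j, j <> i -> x j = x' j) ->
    rev (mkseq x' n) = s1 ++ x' i :: s2.
Proof.
move=> lt_in; exists (rev (map x (iota i.+1 (n - i.+1)))), (rev (mkseq x i)).
move=> x' xx'; have -> : n = (i + (n - i.+1).+1)%N by lia.
have -> : (i + (n - i.+1).+1 - i.+1 = n - i.+1)%N by lia.
move: (n - i.+1)%N => m; rewrite /mkseq iotaD map_cat /= rev_cat rev_cons cat_rcons.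
have mapE k j : (forall l, l \in iota k j -> l <> i) ->
    map x' (iota k j) = map x (iota k j).
  by move=> h; apply/eq_in_map => l /h /xx' ->.
rewrite !mapE// => l; rewrite mem_iota; lia.
Qed.

Lemma segment_mechanism_DP : dynamic_DP eps delta segment_mechanism.
Proof.
move=> x x' [i [xx' none same]] S mS.
pose G c n (w : measurableTypeR R) := release_code (mkseq (if c then x else x') n.+1) w.
pose tr m := choice.pickle (behead (code_transcript m)).
apply: (@seq_event_indistinguishable R _ (measurableTypeR R) unit_uniform G tr _ _
  (expR eps) delta _ _ S mS).
- move=> c n w; rewrite /G /tr /code_transcript /release_code choice.pickleK /=.
  by rewrite [mkseq _ n.+2]mkseqS rev_rcons.
- move=> c n A; exact: (measurable_transcript_in _ (fun ys => A (choice.pickle ys))).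
- exact: expR_ge0.
move=> n A; have [lt_in|le_ni] := ltnP i n.+1.
  have [s1 [s2 sE]] := rev_mkseq_split x lt_in.
  have xE := sE x (fun _ _ => erefl); have x'E := sE x' same.
  rewrite /G /release_code xE x'E; move: xx'.
  have := prefix_DP s1 s2 _ (fun ys => A (choice.pickle ys)).
  case: (x i) none => [a|] [] // e; rewrite ?e => dp xx'.
  - by case: (dp a).
  - by case: (x' i) xx' => // a _; case: (dp a).
  - by case: xx'.
change (unit_uniform [set w | A (release_code (mkseq x n.+1) w)] <=
  (expR eps)%:E * unit_uniform [set w | A (release_code (mkseq x' n.+1) w)] +
  delta%:E)%E.
have -> : mkseq x n.+1 = mkseq x' n.+1.
  apply/eq_in_map => j; rewrite mem_iota => /andP[_ lt_j].
  by apply: same => ji; move: lt_j le_ni; rewrite ji; lia.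
set p := unit_uniform _; apply: (@le_trans _ _ ((expR eps)%:E * p)%E); last first.
  by rewrite leeDl.
have e1 : (1%:E <= (expR eps)%:E)%E by rewrite lee_fin -expR0 ler_expR ltW.
by rewrite -[leLHS]mul1e; apply: lee_wpmul2r; first exact: measure_ge0.
Qed.

(** * Accuracy at a fixed time *)

Section utility.
Variables (x : stream X) (t : nat).
Hypothesis t_gt0 : (0 < t)%N.

Let s := rev (mkseq x t).

Let size_s : size s = t. Proof. by rewrite size_rev size_mkseq. Qed.

Lemma last_releases w :
  last 0%N [tuple @releases R X Q segment_mechanism x w i | i < t] = release_code (mkseq x t) w.
Proof.
case: t t_gt0 => // k _; rewrite (last_nth 0%N) size_tuple.
rewrite -[nth _ _ _]/(nth 0%N [tuple @releases R X Q segment_mechanism x w i | i < k.+1] k).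
rewrite (nth_map ord0) ?size_enum_ord//=.
by rewrite /releases nth_enum_ord.
Qed.

Lemma perm_dataset : perm_eq (dataset x t) (pmap id s).
Proof.
rewrite (perm_trans (perm_eq_seq_mset _))// perm_sym /s.
have : perm_eq (pmap id (rev (mkseq x t))) (pmap id (mkseq x t)).
  by apply: perm_pmap; rewrite perm_rev.
move=> /perm_trans -> //; rewrite /mkseq; elim: (iota 0 t) => //= j r IH.
by case: (x j) => //= a; rewrite perm_cons.
Qed.

Lemma size_dataset : size (dataset x t) = count isSome s.
Proof. by rewrite (perm_size perm_dataset) size_pmap. Qed.

Lemma query_dataset f : query q f (dataset x t) = \sum_(y <- pmap id s) q f y.
Proof. exact/perm_big/perm_dataset. Qed.

Lemma query_levels b f :
  query q f (\big[@msetD X/@mset0 X]_(l < levels gain b) level_data gain s b l) =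
  \sum_(p <- tagged s (behead b) | (p.1 < count id b)%N) q f p.2.
Proof.
rewrite -(sum_levels gain) (big_morph (query q f) (query_msetD q f) (query_mset0 q f)).
by apply: eq_bigr => l _; rewrite query_seq_mset.
Qed.

Lemma total_size_levels b : size b = t ->
  total_size (fun l : 'I_(levels gain b) => level_data gain s b l) = covered s b.
Proof.
move=> sz; rewrite /total_size -count_tagged ?size_s//.
transitivity (\sum_(l < levels gain b) \sum_(y <- level_items gain s b l) 1)%N.
  apply: eq_bigr => l _; rewrite (perm_size (perm_eq_seq_mset _)).
  by rewrite sum1_size.
by rewrite (sum_levels gain (fun=> 1%N)) sum1_count.
Qed.

Lemma query_open b f : size b = t ->
  0 <= query q f (dataset x t) -
    query q f (\big[@msetD X/@mset0 X]_(l < levels gain b) level_data gain s b l)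
    <= (pend s b)%:R.
Proof.
move=> sz; rewrite query_dataset query_levels.
by apply: sum_open_le; [rewrite size_s | exact: q01].
Qed.

Lemma query_le_size f : 0 <= query q f (dataset x t) <= (size (dataset x t))%:R.
Proof.
rewrite /query sumr_ge0 => [|y _]; last by case/andP: (q01 f y).
apply: (@le_trans _ _ (\sum_(y <- dataset x t) 1)).
  by apply: ler_sum => y _; case/andP: (q01 f y).
by rewrite -(natr_sum _ _ _ (fun=> 1%N)) sum1_size.
Qed.

Let unit_error : R := eps^-1 * Num.max 1 (ln (t%:R / beta)).

Let inv_eps_le : eps^-1 <= unit_error.
Proof. by rewrite /unit_error ler_peMr ?invr_ge0 ?(ltW eps_gt0)// le_max lexx. Qed.

Let thr_le : thr t <= 36 * unit_error.
Proof. exact: threshold_bound. Qed.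

Let n := size (dataset x t).
Let L := clog (n + clog (clog t)).

Let L_gt0 : (0 < L)%N. Proof. exact: clog_gt0. Qed.

Let admissible_L : admissible pure (eps / L%:R) (delta / L%:R) beta.
Proof.
have L1 : 1 <= L%:R :> R by rewrite ler1n.
split=> //; first by rewrite divr_gt0// ltr0n.
case: adm => _ + _; case: pure => [->|/andP[d0 d1]]; first by rewrite mul0r.
rewrite divr_gt0 ?ltr0n//= ltr_pdivrMr ?ltr0n// mul1r.
by apply: lt_le_trans d1 L1.
Qed.

Let main_error := alpha L (eps / L%:R) (delta / L%:R) beta n.

Let main_error_ge0 : 0 <= main_error.
Proof.
have [_ err] := static_M admissible_L.
(* One run on all the data and the others on nothing realise the total size [n] with [L] runs. *)
pose D (i : 'I_L) : {mset X}%mset := if i == 0%N :> nat then dataset x t else mset0.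
have -> : main_error = alpha L (eps / L%:R) (delta / L%:R) beta (total_size D).
  congr alpha; rewrite /total_size (bigD1 (Ordinal L_gt0))//= big1 ?addn0//.
  move=> i; rewrite -val_eqE /= => /negbTE i0; rewrite /D i0.
  by rewrite size_mset0.
by have /andP[_ b1] := beta01; exact: (@error_fun_ge0 _ _ _ _ _ _ _ _ D b1 err L_gt0).
Qed.

Let good_facts b : size b = t -> good thr s b ->
  [/\ (gains gain b <= covered s b)%N, (covered s b <= 9 * gains gain b)%N,
      n = (covered s b + pend s b)%N & (pend s b)%:R <= 2 * thr t].
Proof.
move=> sz gb; have szs : size b = size s by rewrite size_s.
have [h1 h2 h3] := good_bounds thr_gt0 (threshold_mono eps_gt0 beta01) szs gb.
by split=> //; [rewrite covered_pend// -size_dataset|rewrite -sz].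
Qed.

(** Here n <= 9 gains + 2 T <= 11 T with T <= 36 [unit_error], and 396 = 11 * 36. *)
Let few_items b : size b = t -> good thr s b -> (gains gain b)%:R < thr t ->
  max_error (fun=> 0) (fun f => query q f (dataset x t)) <= 396 * unit_error.
Proof.
move=> sz gb lt_thr; have [h1 h2 nE h3] := good_facts sz gb.
have u0 : 0 <= unit_error by apply: le_trans inv_eps_le; rewrite invr_ge0 ltW.
apply: max_error_le => [|f]; first by lra.
have /andP[q0 qn] := query_le_size f.
rewrite sub0r normrN ger0_norm//; apply: (le_trans qn).
move: h2; rewrite -/n nE -(ler_nat R) natrM natrD; move: lt_thr h3 thr_le.
move: unit_error (thr t) (covered s b)%:R (pend s b)%:R (gains gain b)%:R.
by move=> u T c p g; lra.
Qed.

(** The guard T <= gains turns n <= 9 gains + 2 T into n <= 11 gains. Thus n and the covered size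
    are comparable, and so are [L] and [2 ^ epoch gain b]. *)
Let levels_within b : size b = t -> good thr s b -> thr t <= (gains gain b)%:R ->
  alpha (levels gain b) (eps * share (epoch gain b)) (delta * share (epoch gain b))
    (beta / 2) (covered s b) <= K 16 * main_error.
Proof.
move=> sz gb le_thr; have [h1 h2 nE h3] := good_facts sz gb.
have n_le : (n <= 11 * gains gain b)%N.
  move: h2; rewrite -!(ler_nat R) nE natrD !natrM; move: le_thr h3.
  move: (thr t) (covered s b)%:R (pend s b)%:R (gains gain b)%:R => T c p g.
  lra.
set m := (gains gain b + clog (clog t))%N.
have m_gt0 : (0 < m)%N by rewrite addn_gt0 clog_gt0 orbT.
have /andP[mL Lm] : (clog m <= L <= 5 * clog m)%N.
  apply: clog_mul16 => //; rewrite /m leq_add2r.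
  rewrite nE (leq_trans h1) ?leq_addr//= -nE.
  by rewrite mulnDr leq_add// leq_pmull.
have [e1 e2] := epoch_bounds m.
have epochE : up_log 2 (clog m) = epoch gain b by rewrite /epoch sz.
rewrite epochE in e1 e2.
have ek : (2 ^ epoch gain b <= 2 * L)%N.
  by apply: (leq_trans (ltnW e1)); rewrite leq_mul2l.
have Lk : (L <= 5 * 2 ^ epoch gain b)%N.
  by apply: (leq_trans Lm); rewrite leq_mul2l.
have e0 := ltW eps_gt0.
apply: alpha_absorbs.
- by rewrite (ler_nat _ 1 16).
- exact: L_gt0.
- by [].
- exact: admissible_L.
- exact: admissible_epoch.
- split; rewrite -natrM ler_nat /levels; move: ek Lk L_gt0; clear.
    by move: L (2 ^ _)%N => l p; lia.
  by move: L (2 ^ _)%N => l p; lia.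
- exact: within_share.
- exact: within_share.
- by split; move: beta_gt0; move: (beta) => B B0; lra.
- split; rewrite -natrM ler_nat.
    apply: (leq_trans n_le); move: h1; clear.
    by move: (gains _ _) (covered _ _) => g c; lia.
  by rewrite nE (leq_trans (leq_addr (pend s b) _))// leq_pmull.
Qed.

(** The open segment, left out of the estimate, has at most 2 T <= 72 [unit_error] items; rounding
    adds one more [unit_error]. *)
Let many_items b z : size b = t -> good thr s b -> thr t <= (gains gain b)%:R ->
  max_error (grid_sum (epoch_grid (epoch gain b)) (levels gain b) z)
    (fun f => query q f
      (\big[@msetD X/@mset0 X]_(l < levels gain b) level_data gain s b l)) <=
    alpha (levels gain b) (eps * share (epoch gain b)) (delta * share (epoch gain b))
      (beta / 2) (covered s b) + eps^-1 ->
  max_error (grid_sum (epoch_grid (epoch gain b)) (levels gain b) z)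
    (fun f => query q f (dataset x t)) <= K 16 * main_error + 73 * unit_error.
Proof.
move=> sz gb le_thr; have [_ _ _ h3] := good_facts sz gb.
have := levels_within sz gb le_thr.
set g := grid_sum _ _ _; set tot := \big[_/_]_(l < _) _.
move=> le_K le_err.
have u0 : 0 <= unit_error by apply: le_trans inv_eps_le; rewrite invr_ge0 ltW.
have bound : max_error g (fun f => query q f tot) + (pend s b)%:R <=
    K 16 * main_error + 73 * unit_error.
  move: le_err le_K h3 thr_le inv_eps_le.
  move: (max_error _ _) (alpha _ _ _ _ _) (K 16 * _) (pend _ _)%:R (thr t) unit_error eps^-1.
  by move=> m a k p T u i; lra.
apply: max_error_le => [|f]; last first.
  apply: le_trans bound; rewrite -(subrK (query q f tot) (g f)) -addrA.
  rewrite (le_trans (ler_normD _ _))// lerD//.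
    exact: (le_max_error g (fun f => query q f tot)).
  have /andP[d0 d1] := query_open f sz.
  by rewrite -normrN opprB ger0_norm.
by apply: le_trans bound; rewrite addr_ge0 ?max_error_ge0.
Qed.

(** [K] is arbitrary, so the maximum with 1 keeps the constant positive; 400 covers both 396 and
    73. *)
Let C := Num.max 1 (K 16) + 400.

Let le_C (r : R) : r <= K 16 * main_error + 73 * unit_error \/ r <= 396 * unit_error ->
  r <= C * error_bound alpha eps delta beta n t.
Proof.
have u0 : 0 <= unit_error by apply: le_trans inv_eps_le; rewrite invr_ge0 ltW.
have -> : error_bound alpha eps delta beta n t = main_error + unit_error by [].
have C1 : 400 <= C by rewrite /C lerDr (le_trans ler01)// le_max lexx.
have KC : K 16 <= C.
  have KM : K 16 <= Num.max 1 (K 16) by rewrite le_max lexx orbT.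
  by move: KM; rewrite /C; move: (Num.max 1 (K 16)) (K 16) => m k; lra.
have h1 : K 16 * main_error <= C * main_error by rewrite ler_wpM2r.
have h2 : 400 * unit_error <= C * unit_error by rewrite ler_wpM2r.
have C0 : 0 <= C := le_trans (ler0n R 400) C1.
have h3 : 0 <= C * main_error := mulr_ge0 C0 main_error_ge0.
rewrite mulrDr; move: h1 h2 h3 u0.
move: (K 16 * _) (C * main_error) (C * unit_error) unit_error => k cm cu u.
by move=> h1 h2 h3 u0 [h|h]; lra.
Qed.

Let failure b z : bool :=
  C * error_bound alpha eps delta beta n t <
  max_error (state_estimate b z) (fun f => query q f (dataset x t)).

Let failure_runs b : size b = t ->
  (mean (runs_law zero_output gain epoch_pmf s b) (fun zs => (failure b (head [::] zs))%:R%:E)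
   <= (~~ good thr s b)%:R%:E + (beta / 2)%:E)%E.
Proof.
move=> sz; have b2 : (0%:E <= (beta / 2)%:E)%E by rewrite lee_fin divr_ge0 ?ltW.
have szs : size b = size s by rewrite size_s.
have pr : pmf (runs_law zero_output gain epoch_pmf s b) by exact: pmf_runs_law.
case: (boolP (good thr s b)) => [gb|_] /=; last first.
  apply: (@le_trans _ _ 1%E); last by rewrite leeDl.
  rewrite -[leRHS](mean_cst pr)//; apply: le_mean => // zs _.
  by rewrite lee_fin lern1 leq_b1.
rewrite add0e (@mean_runs_law _ _ _ zero_output gain epoch_pmf pmf_epoch s b
   (fun z => (failure b z)%:R%:E))//; last first.
  by apply/eqP => b0; move: t_gt0; rewrite -sz b0.
have prp : pmf (prod_pmf (levels gain b)
    (fun l => epoch_pmf (epoch gain b) (level_data gain s b l))).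
  by apply: pmf_prod => l; exact: pmf_epoch.
have [le_thr|lt_thr] := leP (thr t) (gains gain b)%:R; last first.
  rewrite -[X in (X <= _)%E](_ : 0%:E = _)//; apply/esym.
  transitivity (mean (prod_pmf (levels gain b)
    (fun l => epoch_pmf (epoch gain b) (level_data gain s b l))) (fun=> 0%:E)).
    apply: eq_mean => z _; rewrite /failure (_ : state_estimate b z = fun=> 0).
      by rewrite ltNge le_C//; right; exact: (few_items sz gb).
    by apply/funext => f; rewrite /state_estimate sz leNgt lt_thr.
  by rewrite mean_cst.
have [_ err] := static_M (admissible_epoch (epoch gain b)).
have k0 : (0 < levels gain b)%N by [].
have grid_le : (levels gain b)%:R * epoch_grid (epoch gain b) <= eps^-1.
  by rewrite /epoch_grid /levels invfM mulrCA mulfV ?mulr1// pnatr_eq0.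
apply: le_trans (rounded_error (epoch_grid_gt0 _) (level_data gain s b) k0 grid_le err).
apply: le_mean => // z _; rewrite lee_fin ler_nat.
have -> : failure b z = (C * error_bound alpha eps delta beta n t <
   max_error (grid_sum (epoch_grid (epoch gain b)) (levels gain b) z)
     (fun f => query q f (dataset x t))).
  by rewrite /failure /state_estimate sz le_thr.
rewrite total_size_levels//.
case: (ltP (C * _)) => //= lt_fail; case: ltP => //= le_err; exfalso.
move: lt_fail; rewrite ltNge le_C//; left; apply: many_items => //.
Qed.

Lemma segment_mechanism_utility :
  ((1 - beta)%:E <= seed_law segment_mechanism
     [set w | (dynamic_error q x t w <= C * error_bound alpha eps delta beta n t)%R])%E.
Proof.
pose Bad : set (seq Y) := [set ys | failure (unzip1 ys) (head [::] (unzip2 ys))].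
have goodE : [set w | dynamic_error (N := segment_mechanism) q x t w <=
      C * error_bound alpha eps delta beta n t] =
    ~` [set w | Bad (transcript s w)].
  apply/seteqP; split => w; rewrite /Bad /failure /dynamic_error /=;
    rewrite /estimate last_releases /code_transcript /release_code choice.pickleK /=;
    by rewrite leNgt => /negP.
rewrite goodE; have mBad := measurable_transcript_in s Bad.
rewrite [X in (_ <= X)%E](probability_setC _ mBad) EFinB leeB//.
rewrite [X in (X <= _)%E](transcript_law_in s Bad).
have failE : (\esum_(ys in Bad) (law s ys)%:E)%E =
    mean (law s) (fun ys => (failure (unzip1 ys) (head [::] (unzip2 ys)))%:R%:E).
  rewrite esum_mkcond; apply: eq_esum => ys _.
  case: ifPn => [/set_mem|]; first by rewrite /Bad /= => ->; rewrite mule1.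
  by rewrite notin_setE /Bad /= => /negP/negbTE ->; rewrite mule0.
rewrite failE (@mean_transcript _ _ _ _ _ _ _ _ pmf_epoch s
  (fun b zs => (failure b (head [::] zs))%:R%:E)); last first.
  by move=> b zs; rewrite lee_fin.
have b2 : 0 <= beta / 2 by rewrite divr_ge0 ?ltW.
apply: (@le_trans _ _ (mean (bits_law (eps / 2) thr s)
   (fun b => (~~ good thr s b)%:R%:E + (beta / 2)%:E)%E)).
  apply: le_mean => [|b /bits_law_size sz]; first exact: pmf_bits.
  by apply: failure_runs; rewrite sz size_s.
have W0 b : 0 <= bits_law (eps / 2) thr s b by exact: bits_law_ge0.
apply: (@le_trans _ _ (mean (bits_law (eps / 2) thr s) (fun b => (~~ good thr s b)%:R%:E) +
   mean (bits_law (eps / 2) thr s) (fun=> (beta / 2)%:E))%E).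
  rewrite /mean -esumD; last 2 first.
  - by move=> b _; rewrite -EFinM lee_fin mulr_ge0.
  - by move=> b _; rewrite -EFinM lee_fin mulr_ge0.
  apply: le_esum => b _; rewrite muleDr//; exact: fin_num_adde_defr.
rewrite mean_cst ?lee_fin//; last exact: pmf_bits.
have eta0 : 0 <= eps / 2 by rewrite divr_ge0 ?ltW.
have bad := bad_bits_prob thr_gt0 eta0 (threshold_tail eps_gt0 beta01) s.
apply: (le_trans (leeD2r _ bad)); rewrite -EFinD lee_fin.
have : 0 <= (size s).+1%:R^-1 :> R by rewrite invr_ge0.
move: (_^-1) => r r0; have : 0 <= beta / 2 * r by rewrite mulr_ge0.
move: (beta) => B; lra.
Qed.

End utility.

End dynamic_mechanism.

Theorem theorem8 (R : realType) (K : R -> R) :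
  exists C : R, 0 < C /\
  forall (X : choiceType) (Q : finType) (q : Q -> X -> R) (pure : bool)
    (M : R -> R -> R -> static_mechanism R X Q)
    (alpha : nat -> R -> R -> R -> nat -> R),
  linear_queries q ->
  (forall eps delta beta : R, admissible pure eps delta beta ->
     static_DP eps delta (M eps delta beta) /\
     has_error q beta (M eps delta beta)
       (fun k n => alpha k eps delta beta n)) ->
  absorbs_constants pure K alpha ->
  forall eps delta beta : R, admissible pure eps delta beta ->
  exists N : dynamic_mechanism R X Q,
    dynamic_DP eps delta N /\
    forall (x : stream X) (t : nat), (0 < t)%N ->
      ((1 - beta)%:E <=
         seed_law N [set w |
           (dynamic_error q x t w <=
             C * error_bound alpha eps delta beta (size (dataset x t)) t)%R])%E.
Proof.
exists (Num.max 1 (K 16) + 400); split.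
  have : 1 <= Num.max 1 (K 16) by rewrite le_max lexx.
  by move: (Num.max 1 (K 16)) => m; lra.
move=> X Q q pure M alpha q01 static_M alpha_absorbs eps delta beta adm.
exists (segment_mechanism M adm); split; first exact: (segment_mechanism_DP static_M).
by move=> x t t0; exact: (segment_mechanism_utility q01 static_M alpha_absorbs adm x t0).
Qed.
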